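(* Let $f$ be $\rho$-weakly convex and $r$ be $\eta$-weakly convex on $\mathbb{X}$ with $\rho,\eta\ge 0$, and let $0<\lambda<\frac{1}{\rho+2\eta}$. Let $\{x^k\}_{k\in\mathbb{N}}$ be generated by Prox-SubGrad for $\min_{x\in\mathbb{X}}\varphi(x)=f(x)+r(x)$. Suppose one of the conditions (B$_{\text{D-D}}$), (B$_3$), (B$_4$) holds, that $\{\beta_k\}$ is a $\sigma$-sequence, and that the stepsizes are $\alpha_k=\beta_k$, with $\beta_k<\frac{1}{2(\frac1\lambda+2\eta+\rho)}$ in case (B$_{\text{D-D}}$) and $\beta_k<\frac{1}{6\eta}$ in cases (B$_3$), (B$_4$). Let $\gamma_1,\gamma_2\ge 0$ be the constants in the recursion $$[\varphi_\lambda(x^{k+1})-\varphi^*]-(1+\gamma_1\beta_k^2)[\varphi_\lambda(x^k)-\varphi^*]\le-\frac{(1-\lambda(\rho+2\eta))\alpha_k}{2}\|\nabla\varphi_\lambda(x^k)\|^2+\gamma_2\beta_k^2,$$ which holds for all $k$ in this setting. Then the following assertions hold: (i) $$\min_{0\le k\le T}\|\nabla\varphi_\lambda(x^k)\|^2\le\Big(\frac{2}{1-\lambda(\rho+2\eta)}\Big)\frac{[\varphi_\lambda(x^0)-\varphi^*]+\gamma_3\sum_{k=0}^T\beta_k^2}{\sum_{k=0}^T\alpha_k}$$ with $\gamma_3\ge\gamma_1[\varphi_\lambda(x^k)-\varphi^*]+\gamma_2$ (for all $k$). If the constant stepsize $\beta_k=\Delta_1/\sqrt{T+1}$ with $\Delta_1>0$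 ($k=0,1,\dots,T$) is used, then $\min_{0\le k\le T}\|\nabla\varphi_\lambda(x^k)\|^2\le R_1/\sqrt{T+1}$ for some $R_1>0$. (ii) For the conditions (B$_3$) and (B$_4$), there exists a positive number $$M_1=\max\Big\{\sqrt{\tfrac{c_3\gamma_3}{\gamma_1}+c_4},\ \sqrt{\tfrac{4c_5\gamma_3^2}{\gamma_1^2\lambda^2}+c_6}\Big\}>0$$ such that $\|g(x^k)+h(x^k)\|\le M_1$ and $\|x^k-x^{k+1}\|\le 2M_1\alpha_k$, where $h(x^k)\in\partial r(x^k)$; and $\lim_{k\to\infty}\|\nabla\varphi_\lambda(x^k)\|=0$.
   Context: Setting: $\mathbb{X}\subseteq\mathbb{R}^d$ is closed and convex; $f,r:\mathbb{X}\to\mathbb{R}$ are proper and lower semicontinuous; $\varphi=f+r$; the set $\mathbb{X}^*$ of minimizers of $\varphi$ over $\mathbb{X}$ is non-empty and $\varphi^*$ is the minimum value. A function $u:\mathbb{X}\to\mathbb{R}$ is $\rho$-weakly convex if $\theta=u+\frac{\rho}{2}\|\cdot\|^2$ is convex; then $\partial u(x)=\partial\theta(x)-\rho x$, where $\partial\theta(x)=\{v:\theta(y)\ge\theta(x)+\langle v,y-x\rangle\ \forall y\in\mathbb{X}\}$. Moreau envelope: $\varphi_\lambda(x)=\min_{y\in\mathbb{X}}\{\varphi(y)+\frac{1}{2\lambda}\|y-x\|^2\}$, with unique minimizer $\mathrm{Prox}_{\lambda,\varphi}(x)$, and $\nabla\varphi_\lambda(x)=\frac1\lambda(x-\mathrm{Prox}_{\lambda,\varphi}(x))$.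 Prox-SubGrad: starting from $x^0\in\mathbb{X}$, for $k=0,1,\dots$ pick $g(x^k)\in\partial f(x^k)$ and a step size $\alpha_k>0$, and set $x^{k+1}=\arg\min_{x\in\mathbb{X}}\langle g(x^k),x\rangle+r(x)+\frac{1}{2\alpha_k}\|x-x^k\|^2$. Conditions (for all $x\in\mathbb{X}$, $g(x)\in\partial f(x)$, $h(x)\in\partial r(x)$): (B$_{\text{D-D}}$) $\|g(x)\|\le L_f$ for a constant $L_f$; (B$_3$) $\|g(x)+h(x)\|\le\sqrt{c_3[\varphi_\lambda(x)-\varphi^*]+c_4}$ for some $c_3,c_4\ge0$; (B$_4$) $\|g(x)+h(x)\|\le\sqrt{c_5\|\nabla\varphi_\lambda(x)\|^2+c_6}$ for some $c_5,c_6\ge0$ (this implies (B$_3$)). A $\sigma$-sequence is a sequence with $\beta_k>0$, $\sum_k\beta_k=\infty$, $\sum_k\beta_k^2<\infty$. Convention: $1/(6\eta)=+\infty$ if $\eta=0$ (and $\frac{1}{\rho+2\eta}=+\infty$ if $\rho=\eta=0$).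
   Formalization: The M_1 part assumes gamma_1>0 (M_1 divides by gamma_1), and M_1>0 is claimed only if c_3*gamma_3+c_4>0 or c_5*gamma_3+c_6>0, since M_1=0 for f=r=0 with all c_i=0; under (B_4), c_3,c_4 are constants of the implied (B_3). *)

(* Defs.v *)
From HB Require Import structures.
From mathcomp Require Import all_boot all_order all_algebra.
From mathcomp Require Import all_classical all_reals all_analysis.

Set Implicit Arguments.
Unset Strict Implicit.
Unset Printing Implicit Defensive.

Import Order.TTheory GRing.Theory Num.Theory.
Import numFieldNormedType.Exports.

Local Open Scope classical_set_scope.
Local Open Scope ring_scope.

(* The library norm on ['rV_d] is the sup norm (same topology); every norm in
   the theorem is Euclidean. *)
Definition dotv (R : realType) (d : nat) (u v : 'rV[R]_d) : R :=
  \sum_(i < d) u 0 i * v 0 i.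

Definition enorm (R : realType) (d : nat) (u : 'rV[R]_d) : R :=
  Num.sqrt (dotv u u).

(* ['D_v F x] has a junk value where [F] is not differentiable; Moreau envelopes
   with a parameter as in the theorem are differentiable on the whole space. *)
Definition gradient (R : realType) (d : nat) (F : 'rV[R]_d -> R)
    (x : 'rV[R]_d) : 'rV[R]_d :=
  \row_(i < d) 'D_(delta_mx 0 i) F x.

(* [x < 1 / y] with the convention [1 / 0 = +oo], for [y >= 0]. *)
Definition lt_recip (R : realType) (x y : R) : Prop := 0 < y -> x < y^-1.

(* Functions on [X] are total functions of which only the values on [X] matter:
   in the subspace topology the condition is void at points outside [X]. *)
Definition lsc_on (R : realType) (d : nat) (X : set 'rV[R]_d)
    (u : 'rV[R]_d -> R) : Prop :=
  lower_semicontinuous (fun x : subspace X => (u x)%:E).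

Definition argmin (R : realType) (d : nat) (X : set 'rV[R]_d)
    (F : 'rV[R]_d -> R) : set 'rV[R]_d :=
  [set x | X x /\ forall y, X y -> F x <= F y].

(* Equal to the minimum of [F] on [X] whenever the minimum is attained. *)
Definition minval (R : realType) (d : nat) (X : set 'rV[R]_d)
    (F : 'rV[R]_d -> R) : R :=
  inf [set F y | y in X].

Definition convexified (R : realType) (d : nat) (rho : R)
    (u : 'rV[R]_d -> R) : 'rV[R]_d -> R :=
  fun x => u x + rho / 2 * enorm x ^+ 2.

Definition weakly_convex (R : realType) (d : nat) (X : set 'rV[R]_d) (rho : R)
    (u : 'rV[R]_d -> R) : Prop :=
  convex_function X (convexified rho u).

Definition subdiff (R : realType) (d : nat) (X : set 'rV[R]_d)
    (theta : 'rV[R]_d -> R) (x : 'rV[R]_d) : set 'rV[R]_d :=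
  [set v | forall y, X y -> theta x + dotv v (y - x) <= theta y].

Definition wsubdiff (R : realType) (d : nat) (X : set 'rV[R]_d) (rho : R)
    (u : 'rV[R]_d -> R) (x : 'rV[R]_d) : set 'rV[R]_d :=
  [set v - rho *: x | v in subdiff X (convexified rho u) x].

Definition moreau (R : realType) (d : nat) (X : set 'rV[R]_d) (lambda : R)
    (phi : 'rV[R]_d -> R) (x : 'rV[R]_d) : R :=
  minval X (fun y => phi y + (2 * lambda)^-1 * enorm (y - x) ^+ 2).

Definition envelope_gap (R : realType) (d : nat) (X : set 'rV[R]_d)
    (lambda : R) (phi : 'rV[R]_d -> R) (x : 'rV[R]_d) : R :=
  moreau X lambda phi x - minval X phi.

Definition env_grad_norm (R : realType) (d : nat) (X : set 'rV[R]_d)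
    (lambda : R) (phi : 'rV[R]_d -> R) (x : 'rV[R]_d) : R :=
  enorm (gradient (moreau X lambda phi) x).

(* [S x] is the subdifferential at [x] and [G x] the set of subgradients that
   may be written g(x).  [G = S] allows every subgradient and a singleton-valued
   [G] is a selection.  The distinction matters: subgradients are tested only
   against points of [X], so at a boundary point [S x] contains its translates
   by normal vectors of [X] and is unbounded as soon as it is nonempty. *)
Definition oracle (R : realType) (d : nat) (X : set 'rV[R]_d)
    (S G : 'rV[R]_d -> set 'rV[R]_d) : Prop :=
  forall x, X x -> G x !=set0 /\ G x `<=` S x.

Definition prox_subgrad_step (R : realType) (d : nat) (X : set 'rV[R]_d)
    (r : 'rV[R]_d -> R) (G : 'rV[R]_d -> set 'rV[R]_d) (alpha : R)
    (x g xnext : 'rV[R]_d) : Prop :=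
  [/\ 0 < alpha, G x g &
      argmin X (fun y => dotv g y + r y +
                         (2 * alpha)^-1 * enorm (y - x) ^+ 2) xnext].

Definition prox_subgrad (R : realType) (d : nat) (X : set 'rV[R]_d)
    (r : 'rV[R]_d -> R) (G : 'rV[R]_d -> set 'rV[R]_d) (alpha : nat -> R)
    (x g : nat -> 'rV[R]_d) : Prop :=
  X (x 0%N) /\
  forall k, prox_subgrad_step X r G (alpha k) (x k) (g k) (x k.+1).

Definition sigma_sequence (R : realType) (beta : nat -> R) : Prop :=
  [/\ forall k, 0 < beta k,
      series beta n @[n --> \oo] --> +oo &
      cvgn (series (fun k => beta k ^+ 2))].

(* The arguments are the constants: [CondDD Lf], [Cond3 c3 c4], [Cond4 c5 c6]. *)
Variant condition (R : realType) : Type :=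
  | CondDD of R
  | Cond3 of R & R
  | Cond4 of R & R.

Definition condition_holds (R : realType) (d : nat) (X : set 'rV[R]_d)
    (f r : 'rV[R]_d -> R) (eta lambda : R)
    (G H : 'rV[R]_d -> set 'rV[R]_d) (C : condition R) : Prop :=
  let phi := f \+ r in
  match C with
  | CondDD Lf => forall x g, X x -> G x g -> enorm g <= Lf
  | Cond3 c3 c4 =>
      [/\ 0 <= c3, 0 <= c4, oracle X (wsubdiff X eta r) H &
          forall x g h, X x -> G x g -> H x h ->
            enorm (g + h) <=
              Num.sqrt (c3 * envelope_gap X lambda phi x + c4)]
  | Cond4 c5 c6 =>
      [/\ 0 <= c5, 0 <= c6, oracle X (wsubdiff X eta r) H &
          forall x g h, X x -> G x g -> H x h ->
            enorm (g + h) <=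
              Num.sqrt (c5 * env_grad_norm X lambda phi x ^+ 2 + c6)]
  end.

Definition step_bound (R : realType) (rho eta lambda : R) (C : condition R)
    (b : R) : Prop :=
  match C with
  | CondDD _ => b < (2 * (lambda^-1 + 2 * eta + rho))^-1
  | Cond3 _ _ | Cond4 _ _ => lt_recip b (6 * eta)
  end.

Definition envelope_recursion (R : realType) (d : nat) (X : set 'rV[R]_d)
    (phi : 'rV[R]_d -> R) (rho eta lambda : R) (alpha beta : nat -> R)
    (x : nat -> 'rV[R]_d) (gamma1 gamma2 : R) : Prop :=
  forall k,
    envelope_gap X lambda phi (x k.+1) -
      (1 + gamma1 * beta k ^+ 2) * envelope_gap X lambda phi (x k)
    <= - ((1 - lambda * (rho + 2 * eta)) * alpha k / 2 *
            env_grad_norm X lambda phi (x k) ^+ 2)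
       + gamma2 * beta k ^+ 2.

Definition gamma3_bound (R : realType) (d : nat) (X : set 'rV[R]_d)
    (phi : 'rV[R]_d -> R) (lambda : R) (x : nat -> 'rV[R]_d)
    (gamma1 gamma2 gamma3 : R) : Prop :=
  forall k, gamma1 * envelope_gap X lambda phi (x k) + gamma2 <= gamma3.

Definition min_grad_sq (R : realType) (d : nat) (X : set 'rV[R]_d)
    (phi : 'rV[R]_d -> R) (lambda : R) (x : nat -> 'rV[R]_d) (T : nat) : R :=
  \big[Num.min/env_grad_norm X lambda phi (x 0%N) ^+ 2]_(0 <= k < T.+1)
    env_grad_norm X lambda phi (x k) ^+ 2.

Definition M1 (R : realType) (lambda gamma1 gamma3 c3 c4 c5 c6 : R) : R :=
  Num.max
    (Num.sqrt (c3 * gamma3 / gamma1 + c4))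
    (Num.sqrt (4 * c5 * gamma3 ^+ 2 / (gamma1 ^+ 2 * lambda ^+ 2) + c6)).

(* The constants that occur in [M1].  Under [Cond3 c3 c4], [c5] and [c6] are
   free.  [Cond4 c5 c6] implies [Cond3 c3 c4] for some [c3], [c4], and these are
   the [c3], [c4] of [M1]; one valid choice is [c3 = 2 * c5 / lambda], [c4 = c6],
   because the squared gradient norm of the envelope is at most [2 / lambda]
   times its gap. *)
Definition M1_constants (R : realType) (d : nat) (X : set 'rV[R]_d)
    (f r : 'rV[R]_d -> R) (eta lambda : R)
    (G H : 'rV[R]_d -> set 'rV[R]_d) (C : condition R)
    (c3 c4 c5 c6 : R) : Prop :=
  match C with
  | CondDD _ => False
  | Cond3 a3 a4 => [/\ c3 = a3, c4 = a4, 0 <= c5 & 0 <= c6]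
  | Cond4 a5 a6 =>
      [/\ c5 = a5, c6 = a6 &
          condition_holds X f r eta lambda G H (Cond3 c3 c4)]
  end.

(* Main.v *)
Require Import Defs.
From HB Require Import structures.
From mathcomp Require Import all_boot all_order all_algebra.
From mathcomp Require Import all_classical all_reals all_analysis.
From mathcomp Require Import ring lra.

Set Implicit Arguments.
Unset Strict Implicit.
Unset Printing Implicit Defensive.

Import Order.TTheory GRing.Theory Num.Theory.
Import numFieldNormedType.Exports.

Local Open Scope classical_set_scope.
Local Open Scope ring_scope.

(* Let p be the proximal point of the k-th iterate.  The envelope at the next
   iterate is at most phi p + |p - x^(k+1)|^2 / (2 lambda).  The objective of the
   step is strongly convex up to eta, so quadratic growth at its minimizer
   x^(k+1), the subgradient inequality for f at x^k and the quadratic growth of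
   the proximal subproblem at p bound |p - x^(k+1)|^2 by
   |p - x^k|^2 - alpha_k (1 / lambda - (rho + 2 eta)) |p - x^k|^2 plus a term of
   order alpha_k^2; since the envelope has gradient (x - p) / lambda, this is the
   recursion.  Discrete Gronwall and telescoping give the rates.  The gradient
   tends to 0 because it is Lipschitz, the steps have length O(alpha_k), and
   sum alpha_k |gradient|^2 is finite while sum alpha_k is not. *)

(** * Euclidean norm *)

Section euclidean.
Context {R : realType} {d : nat}.
Implicit Types (u v w : 'rV[R]_d) (a : R).

Lemma dotvC u v : dotv u v = dotv v u.
Proof. by apply: eq_bigr => i _; rewrite mulrC. Qed.

Lemma dotvDl u v w : dotv (u + v) w = dotv u w + dotv v w.
Proof. by rewrite -big_split; apply: eq_bigr => i _; rewrite mxE mulrDl. Qed.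

Lemma dotvZl a u v : dotv (a *: u) v = a * dotv u v.
Proof. by rewrite /dotv mulr_sumr; apply: eq_bigr => i _; rewrite mxE mulrA. Qed.

Lemma dotvNl u v : dotv (- u) v = - dotv u v.
Proof. by rewrite -scaleN1r dotvZl mulN1r. Qed.

Lemma dotvDr u v w : dotv u (v + w) = dotv u v + dotv u w.
Proof. by rewrite !(dotvC u) dotvDl. Qed.

Lemma dotvZr a u v : dotv u (a *: v) = a * dotv u v.
Proof. by rewrite !(dotvC u) dotvZl. Qed.

Lemma dotvNr u v : dotv u (- v) = - dotv u v.
Proof. by rewrite !(dotvC u) dotvNl. Qed.

Definition dotvE := (dotvDl, dotvDr, dotvNl, dotvNr, dotvZl, dotvZr).

Lemma dotv_ge0 u : 0 <= dotv u u.
Proof. by apply: sumr_ge0 => i _; rewrite -expr2 sqr_ge0. Qed.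

Lemma enorm_ge0 u : 0 <= enorm u.
Proof. exact: sqrtr_ge0. Qed.

Lemma enorm_sqr u : enorm u ^+ 2 = dotv u u.
Proof. by rewrite sqr_sqrtr ?dotv_ge0. Qed.

Lemma dotv0l u : dotv 0 u = 0.
Proof. by rewrite -(scale0r u) dotvZl mul0r. Qed.

Lemma enormB u v : enorm (u - v) = enorm (v - u).
Proof. by rewrite /enorm -opprB dotvNl dotvNr opprK. Qed.

Lemma enormZ a u : enorm (a *: u) = `|a| * enorm u.
Proof.
by rewrite /enorm dotvZl dotvZr mulrA -expr2 sqrtrM ?sqr_ge0// sqrtr_sqr.
Qed.

Lemma coord_le_enorm u i : `|u 0 i| <= enorm u.
Proof.
rewrite -sqrtr_sqr ler_sqrt ?dotv_ge0// /dotv (bigD1 i)//= expr2 lerDl.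
by apply: sumr_ge0 => j _; rewrite -expr2 sqr_ge0.
Qed.

Lemma enorm0_eq0 u : enorm u = 0 -> u = 0.
Proof.
move=> u0; apply/rowP => i; rewrite mxE; apply/normr0_eq0.
by apply/eqP; rewrite eq_le normr_ge0 -u0 coord_le_enorm.
Qed.

(** Expand [|a u - v|^2 >= 0]. The weight [a] is tuned at each use to fix how much of [|v|^2] is
    spent. *)
Lemma dotv_young a u v : 2 * a * dotv u v <= a ^+ 2 * dotv u u + dotv v v.
Proof.
have := dotv_ge0 (a *: u - v); rewrite !dotvE (dotvC v u); nra.
Qed.

Lemma dotv_le_enorm u v : dotv u v <= enorm u * enorm v.
Proof.
have [u0|un0] := eqVneq (enorm u) 0.
  by rewrite (enorm0_eq0 u0) dotv0l mulr_ge0 ?enorm_ge0.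
have [v0|vn0] := eqVneq (enorm v) 0.
  by rewrite (enorm0_eq0 v0) dotvC dotv0l mulr_ge0 ?enorm_ge0.
have u_gt0 : 0 < enorm u by rewrite lt_neqAle eq_sym un0 enorm_ge0.
have v_gt0 : 0 < enorm v by rewrite lt_neqAle eq_sym vn0 enorm_ge0.
(* This weight makes the two squares on the right equal, which turns Young's inequality into
   Cauchy-Schwarz. *)
have := dotv_young (enorm v / enorm u) u v.
rewrite -!enorm_sqr -exprMn divfK//.
have -> : 2 * (enorm v / enorm u) * dotv u v =
          2 * enorm v * dotv u v / enorm u by field.
rewrite ler_pdivrMr// => h; rewrite -(ler_pM2l v_gt0); nra.
Qed.

Lemma enormD u v : enorm (u + v) <= enorm u + enorm v.
Proof.
rewrite -(@ler_pXn2r _ 2%N) ?nnegrE ?enorm_ge0 ?addr_ge0 ?enorm_ge0//.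
rewrite enorm_sqr !dotvE (dotvC v u) sqrrD !enorm_sqr.
have := dotv_le_enorm u v; lra.
Qed.

Lemma enorm_dist_le u v : `|enorm u - enorm v| <= enorm (u - v).
Proof.
rewrite ler_norml; apply/andP; split.
  by have := enormD (v - u) u; rewrite subrK enormB; lra.
by have := enormD (u - v) v; rewrite subrK; lra.
Qed.

(** [bounded_set] refers to the sup norm; this carries Euclidean bounds over to it. *)
Lemma norm_le_enorm u : `|u| <= enorm u.
Proof.
rewrite [leLHS]/Num.norm/= mx_normrE; apply/bigmax_leP; split=> [|[i j] _/=].
  exact: enorm_ge0.
by rewrite (ord1 i) coord_le_enorm.
Qed.

Lemma enorm_sqr_continuous (x : 'rV[R]_d) :
  continuous (fun y : 'rV[R]_d => enorm (y - x) ^+ 2).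
Proof.
have -> : (fun y : 'rV[R]_d => enorm (y - x) ^+ 2) =
          (fun y => \sum_i (y 0 i - x 0 i) * (y 0 i - x 0 i)).
  by apply/funext => y; rewrite enorm_sqr; apply: eq_bigr => i _; rewrite !mxE.
apply: (continuous_big (x0 := 0)) => [|i _]; first exact: add_continuous.
have c : continuous (fun z : 'rV[R]_d => z 0 i - x 0 i).
  by move=> y; apply: continuousB; [exact: coord_continuous|exact: cst_continuous].
by move=> y; exact: (continuousM (c y) (c y)).
Qed.

End euclidean.

(** * Convexity with a modulus *)

Section strong_convexity.
Context {R : realType} {d : nat}.
Implicit Types (X : set 'rV[R]_d) (F u : 'rV[R]_d -> R) (x y : 'rV[R]_d).

(* [F] is convex of modulus [m]; a negative [m] gives weak convexity. *)
Definition modulus_convex X (m : R) F :=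
  forall x y (t : R), X x -> X y -> 0 < t -> t < 1 ->
    F (t *: x + (1 - t) *: y) <=
      t * F x + (1 - t) * F y - m / 2 * (t * (1 - t)) * enorm (x - y) ^+ 2.

Lemma convex_setP X : convex_set X ->
  forall x y (t : R), X x -> X y -> 0 < t -> t < 1 ->
    X (t *: x + (1 - t) *: y).
Proof.
move=> Xc x y t Xx Xy t0 t1.
have := Xc x y (Itv01 (ltW t0) (ltW t1)) (mem_set Xx) (mem_set Xy).
by rewrite inE.
Qed.

Lemma enorm_sqr_conv (x y : 'rV[R]_d) (t : R) :
  enorm (t *: x + (1 - t) *: y) ^+ 2 =
    t * enorm x ^+ 2 + (1 - t) * enorm y ^+ 2 -
    t * (1 - t) * enorm (x - y) ^+ 2.
Proof. by rewrite !enorm_sqr !dotvE (dotvC y x); ring. Qed.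

(** By [enorm_sqr_conv] the added square has modulus exactly [rho], and removing it leaves [- rho].
    In this form the moduli of summands simply add up. *)
Lemma weakly_convex_modulus X (rho : R) u :
  weakly_convex X rho u -> modulus_convex X (- rho) u.
Proof.
move=> uc x y t Xx Xy t0 t1.
have := uc (Itv01 (ltW t0) (ltW t1)) x y (mem_set Xx) (mem_set Xy).
rewrite convRE/= /convexified.
have -> : conv (Itv01 (ltW t0) (ltW t1)) (x : convex_lmodType 'rV[R]_d) y =
  t *: x + (1 - t) *: y by [].
rewrite enorm_sqr_conv /unstable.onem; lra.
Qed.

Lemma modulus_convexD X (m n : R) F u :
  modulus_convex X m F -> modulus_convex X n u ->
  modulus_convex X (m + n) (F \+ u).
Proof.
move=> Fc uc x y t Xx Xy t0 t1.
have := Fc _ _ _ Xx Xy t0 t1; have := uc _ _ _ Xx Xy t0 t1; rewrite /=; lra.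
Qed.

Lemma modulus_convex_dotv X v : modulus_convex X 0 (dotv v).
Proof. by move=> x y t _ _ _ _; rewrite !dotvE; lra. Qed.

Lemma modulus_convex_sqr X (c : R) z :
  modulus_convex X (2 * c) (fun y => c * enorm (y - z) ^+ 2).
Proof.
move=> x y t _ _ _ _.
have -> : t *: x + (1 - t) *: y - z = t *: (x - z) + (1 - t) *: (y - z).
  by rewrite !scalerBr addrACA -opprD -scalerDl subrKC scale1r.
have -> : x - y = (x - z) - (y - z) by rewrite opprB addrA subrK.
by rewrite enorm_sqr_conv; lra.
Qed.

(* Test minimality on the segment from [p] to [y] and let [t] tend to 0. *)
Lemma argmin_growth X (m : R) F p : convex_set X -> modulus_convex X m F ->
  argmin X F p -> forall y, X y -> F p + m / 2 * enorm (y - p) ^+ 2 <= F y.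
Proof.
move=> Xc Fc [Xp pmin] y Xy; set D := m / 2 * _.
have key t : 0 < t -> t < 1 -> F p + (1 - t) * D <= F y.
  move=> t0 t1; rewrite -(ler_pM2l t0).
  have := pmin _ (convex_setP Xc Xy Xp t0 t1).
  have := Fc _ _ _ Xy Xp t0 t1; rewrite /D; lra.
rewrite leNgt; apply/negP => lt_y.
have [D_le0|D_gt0] := leP D 0.
  by have := key (1/2); rewrite /D in D_le0 lt_y *; lra.
set e := F p + D - F y.
have e_gt0 : 0 < e by rewrite /e; lra.
have De : 0 < e + 2 * D by lra.
(* [key] gives [e <= t * D] for every [t] in []0, 1[]; at this [t] the right-hand side is below
   [e / 2]. *)
have := key (e / (e + 2 * D)).
rewrite divr_gt0// ltr_pdivrMr// mul1r => /(_ isT).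
have -> : e < e + 2 * D by lra.
move=> /(_ isT) h.
have : e <= e / (e + 2 * D) * D by rewrite {1}/e; lra.
by rewrite mulrAC ler_pdivlMr//; nra.
Qed.

Lemma minval_argmin X F p : argmin X F p -> minval X F = F p.
Proof.
move=> [Xp pmin]; apply/eqP; rewrite eq_le; apply/andP; split.
  apply: ge_inf; last by exists p.
  by exists (F p) => _ [y Xy <-]; exact: pmin.
apply: lb_le_inf; first by exists (F p), p.
by move=> _ [y Xy <-]; exact: pmin.
Qed.

(** The two squares in [convexified] and the shift by [rho *: x] combine into the single error term
    [rho / 2 * |y - x|^2]. *)
Lemma wsubdiff_ineq X (rho : R) u x v : wsubdiff X rho u x v ->
  forall y, X y -> u x + dotv v (y - x) - rho / 2 * enorm (y - x) ^+ 2 <= u y.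
Proof.
move=> [w wsub <-] y /wsub; rewrite /convexified !enorm_sqr !dotvE (dotvC y x).
lra.
Qed.

End strong_convexity.

(** * Existence of proximal points *)

Section existence_of_minimizers.
Context {R : realType} {d : nat}.
Implicit Types (X K : set 'rV[R]_d) (F u v : 'rV[R]_d -> R).

(** A real-valued form of relative lower semicontinuity, stated with neighbourhoods of the ambient
    space so that sums and restrictions to subsets are direct. *)
Definition lsc_within X u :=
  forall p a, X p -> a < u p -> \forall y \near p, X y -> a < u y.

Lemma lsc_onW X u : lsc_on X u -> lsc_within X u.
Proof.
move=> ul p a Xp; rewrite -lte_fin => /(ul p a)[V Vp aV].
have : nbhs (p : subspace X) V by [].
rewrite /nbhs/= -(nbhs_subspace_in Xp) => XV.
move: XV; rewrite /within/=; apply: filterS => y Vy Xy.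
by have := aV y (Vy Xy); rewrite /= lte_fin.
Qed.

Lemma lsc_withinS X K u : K `<=` X -> lsc_within X u -> lsc_within K u.
Proof.
move=> KX ul p a Kp /(ul _ _ (KX _ Kp)).
by apply: filterS => y h /KX; exact: h.
Qed.

Lemma lsc_withinD X u v :
  lsc_within X u -> lsc_within X v -> lsc_within X (u \+ v).
Proof.
move=> ul vl p a Xp /= lt_a; pose e := (u p + v p - a) / 2.
have e_gt0 : 0 < e by rewrite /e; lra.
have hu : u p - e < u p by lra.
have hv : v p - e < v p by lra.
near=> y => Xy.
have : X y -> u p - e < u y by near: y; exact: ul.
have : X y -> v p - e < v y by near: y; exact: vl.
by move=> /(_ Xy) + /(_ Xy); rewrite /e; lra.
Unshelve. all: by end_near. Qed.

Lemma continuous_lsc_within X u : continuous u -> lsc_within X u.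
Proof.
move=> uc p a _ lt_a.
have h : \forall y \near p, a < u y by exact: (cvgr_gt (u p) (uc p) a lt_a).
by near=> y => _; near: y.
Unshelve. all: by end_near.
Qed.

(** The sets of points of [K] with [F y < i + e] generate a proper filter, which clusters at some
    [p] by compactness. If [F p] exceeded the infimum [i], lower semicontinuity would keep [F] above
    some [i + e] near [p], against clustering. *)
Lemma compact_argmin K F (m : R) : compact K -> K !=set0 ->
  lsc_within K F -> (forall y, K y -> m <= F y) -> argmin K F !=set0.
Proof.
move=> Kc [y0 Ky0] Fl Fm; set i := minval K F.
have lbF : has_lbound [set F y | y in K].
  by exists m => _ [y Ky <-]; exact: Fm.
have hinf : has_inf [set F y | y in K] by split => //; exists (F y0), y0.
have iF y : K y -> i <= F y by move=> Ky; apply: ge_inf => //; exists y.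
pose L := filter_from [set e : R | 0 < e] (fun e => K `&` [set y | F y < i + e]).
have Lf : ProperFilter L.
  apply: filter_from_proper.
    apply: filter_from_filter; first by exists 1 => /=.
    move=> a b /= a_gt0 b_gt0; exists (Num.min a b) => /=.
      by rewrite lt_min a_gt0.
    move=> y [Ky]; rewrite /= => h; split; split=> //=; apply: lt_le_trans h _;
      by rewrite lerD2l ge_min lexx ?orbT.
  move=> e /= e_gt0; have [_ [y Ky <-] h] := inf_adherent e_gt0 hinf.
  by exists y.
have LK : L K by exists 1 => //= y [].
have [p [Kp pcl]] := Kc L Lf LK.
exists p; split=> // y Ky; apply: le_trans (iF _ Ky).
rewrite leNgt; apply/negP => lt_p.
pose e := (F p - i) / 2.
have Fp : i + e < F p by rewrite /e; lra.
have e_gt0 : 0 < e by rewrite /e; lra.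
have Le : L (K `&` [set y | F y < i + e]) by exists e.
have [z [[Kz /= h1] /= /(_ Kz)]] := pcl _ _ Le (Fl _ _ Kp Fp).
by rewrite ltNge (ltW h1).
Qed.

(** Points farther from [x] than the minimizer [s] of [F] do no better than [s] in either summand,
    so it suffices to minimize over a closed ball intersected with [X], which is compact. *)
Lemma prox_exists X F (c : R) (x : 'rV[R]_d) : closed X ->
  lsc_within X F -> argmin X F !=set0 -> 0 < c ->
  argmin X (fun y => F y + c * enorm (y - x) ^+ 2) !=set0.
Proof.
move=> Xcl Fl [s [Xs smin]] c_gt0.
set Q := fun y => _.
pose K := X `&` [set y | enorm (y - x) ^+ 2 <= enorm (s - x) ^+ 2].
have Ks : K s by split => /=.
have Kcl : closed K.
  apply: closedI => //.
  apply: (@preimage_closed _ R (fun y : 'rV[R]_d => enorm (y - x) ^+ 2)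
    [set t : R | t <= enorm (s - x) ^+ 2]); last exact: closed_le.
  by move=> y _; exact: enorm_sqr_continuous.
have Kb : bounded_set K.
  exists (enorm (s - x) + `|x|); split; first by rewrite num_real.
  move=> M /ltW hM y [_ /= hy]; apply: le_trans hM.
  have -> : y = (y - x) + x by rewrite subrK.
  apply: le_trans (ler_normD _ _) _; rewrite lerD2r.
  apply: le_trans (norm_le_enorm _) _.
  by rewrite -(@ler_pXn2r _ 2%N) ?nnegrE ?enorm_ge0.
have Ql : lsc_within K Q.
  apply: (@lsc_withinS X) => [y []//|]; apply: lsc_withinD => //.
  apply: continuous_lsc_within => y.
  exact: (continuousM (@cst_continuous _ R c y) (@enorm_sqr_continuous _ _ x y)).
have [p [[Xp _] pmin]] : argmin K Q !=set0.
  apply: (@compact_argmin _ _ (F s)) => //.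
  - exact: bounded_closed_compact.
  - by exists s.
  - move=> y [Xy _]; rewrite /Q.
    by have := smin _ Xy; have := sqr_ge0 (enorm (y - x)); nra.
exists p; split=> // y Xy; have [Ky|nK] := pselect (K y); first exact: pmin.
apply: le_trans (pmin _ Ks) _; rewrite /Q; apply: lerD; first exact: smin.
rewrite ler_pM2l// leNgt; apply/negP => lt_y; apply: nK; split => //=.
exact: ltW.
Qed.

End existence_of_minimizers.

(** * Moreau envelope *)

Section moreau_envelope.
Context {R : realType} {d : nat}.
Implicit Types (x y p q : 'rV[R]_d).

(** A remainder of size [C h^2] puts the difference quotient within [C |h|] of [l]; the limit is
    thus a genuine one and not the junk value. *)
Lemma quadratic_derive (F : 'rV[R]_d -> R) (x v : 'rV[R]_d) (l C : R) :
  (forall h, `|F (h *: v + x) - F x - h * l| <= C * h ^+ 2) -> 'D_v F x = l.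
Proof.
move=> FC; apply: cvg_lim => //.
have C_ge0 : 0 <= C.
  by have := FC 1; rewrite expr1n mulr1; apply: le_trans.
apply/cvgrPdist_le => e e_gt0; near=> h.
have h_neq0 : h != 0 by near: h; exact: nbhs_dnbhs_neq.
(* The denominator [C + 1] is positive even when [C = 0]. *)
have h_le : `|h| <= e / (C + 1).
  near: h; apply: dnbhs0_le; rewrite divr_gt0//; lra.
have h_gt0 : 0 < `|h| by rewrite normr_gt0.
rewrite -(ler_pM2l h_gt0) -normrM /=.
have -> : h * (l - h^-1 *: (F (h *: v + x) - F x)) =
    - (F (h *: v + x) - F x - h * l).
  rewrite mulrBr -[h^-1 *: _]/(h^-1 * _) mulVKf//; ring.
rewrite normrN; apply: le_trans (FC h) _.
rewrite -(real_normK (num_real h)).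
move: h_le; rewrite ler_pdivlMr; last by lra.
nra.
Unshelve. all: by end_near. Qed.

Variables (X : set 'rV[R]_d) (phi : 'rV[R]_d -> R) (s lambda : R).

Definition prox x := argmin X (fun y => phi y + (2 * lambda)^-1 * enorm (y - x) ^+ 2).

Hypotheses (Xconvex : convex_set X) (phi_convex : modulus_convex X (- s) phi).
Hypotheses (lambda_gt0 : 0 < lambda) (lambda_lt : lambda * s < 1).
Hypothesis prox_neq0 : forall x, prox x !=set0.
Hypothesis has_min : argmin X phi !=set0.

(** The modulus of strong convexity of the proximal objective: [1 / lambda] from the square, less
    [s] from [phi]. *)
Let mu := lambda^-1 - s.

Let mu_gt0 : 0 < mu.
Proof. by rewrite /mu subr_gt0 -(ltr_pM2l lambda_gt0) divff ?gt_eqF. Qed.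

Lemma moreauE x p : prox x p ->
  moreau X lambda phi x = phi p + (2 * lambda)^-1 * enorm (p - x) ^+ 2.
Proof. exact: minval_argmin. Qed.

Lemma prox_growth x p y : prox x p -> X y ->
  moreau X lambda phi x + (lambda^-1 - s) / 2 * enorm (y - p) ^+ 2 <=
    phi y + (2 * lambda)^-1 * enorm (y - x) ^+ 2.
Proof.
move=> px Xy; rewrite (moreauE px).
have := modulus_convexD phi_convex (@modulus_convex_sqr _ _ X (2 * lambda)^-1 x).
have -> : - s + 2 * (2 * lambda)^-1 = lambda^-1 - s.
  by field; rewrite gt_eqF.
by move=> /(argmin_growth Xconvex)/(_ px); exact.
Qed.

Lemma moreau_le x y : X y ->
  moreau X lambda phi x <= phi y + (2 * lambda)^-1 * enorm (y - x) ^+ 2.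
Proof. by have [p px] := prox_neq0 x; rewrite (moreauE px); apply: px.2. Qed.

(* Young's inequality, used to absorb the cross term [<z - p, y - x> / lambda]
   in the quadratic growth of the proximal subproblem at [x]. *)
Lemma moreau_quadratic x p y : prox x p ->
  `|moreau X lambda phi y - moreau X lambda phi x -
      dotv (lambda^-1 *: (x - p)) (y - x)| <=
    ((2 * lambda)^-1 + (2 * mu * lambda ^+ 2)^-1) * enorm (y - x) ^+ 2.
Proof.
move=> px; have [q qy] := prox_neq0 y.
have l0 : lambda != 0 by rewrite gt_eqF.
have m0 : mu != 0 by rewrite gt_eqF.
have il : 0 < (2 * lambda)^-1 by rewrite invr_gt0 mulr_gt0.
have ilE : lambda^-1 = 2 * (2 * lambda)^-1 by field.
set a := (2 * lambda)^-1 in il ilE *.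
have sq_ge0 := sqr_ge0 (enorm (y - x)).
have im : 0 <= (2 * mu * lambda ^+ 2)^-1.
  by rewrite invr_ge0 !mulr_ge0 ?sqr_ge0// ltW.
(* Upper bound: [p] is a competitor in the proximal problem at [y]. *)
have ub : moreau X lambda phi y - moreau X lambda phi x -
    dotv (lambda^-1 *: (x - p)) (y - x) <= a * enorm (y - x) ^+ 2.
  have := moreau_le y px.1; rewrite (moreauE px) -/a ilE.
  rewrite !enorm_sqr !dotvE ?(dotvC y x) ?(dotvC y p) ?(dotvC x p); lra.
(* Lower bound: the growth of the problem at [x] is evaluated at [q], the proximal point of [y]. *)
have lb : - (2 * mu * lambda ^+ 2)^-1 * enorm (y - x) ^+ 2 <=
    moreau X lambda phi y - moreau X lambda phi x -
    dotv (lambda^-1 *: (x - p)) (y - x).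
  have h1 := prox_growth px qy.1; rewrite -/mu -/a in h1.
  have h2 : lambda^-1 * dotv (q - p) (y - x) <=
      mu / 2 * enorm (q - p) ^+ 2 +
      (2 * mu * lambda ^+ 2)^-1 * enorm (y - x) ^+ 2.
    have := dotv_young (mu * lambda) (q - p) (y - x).
    rewrite -!enorm_sqr => h.
    have c_gt0 : 0 < 2 * mu * lambda ^+ 2 by rewrite !mulr_gt0 ?exprn_gt0.
    rewrite -(ler_pM2l c_gt0).
    have -> : 2 * mu * lambda ^+ 2 * (lambda^-1 * dotv (q - p) (y - x)) =
      2 * (mu * lambda) * dotv (q - p) (y - x) by field.
    apply: le_trans h _; rewrite le_eqVlt; apply/orP; left; apply/eqP.
    by field; rewrite l0 m0.
  rewrite (moreauE qy) -/a; move: h1 h2; rewrite ilE.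
  set D := enorm (q - p) ^+ 2.
  rewrite !enorm_sqr !dotvE ?(dotvC y x) ?(dotvC y p) ?(dotvC x p).
  rewrite ?(dotvC y q) ?(dotvC x q); move: (dotv_ge0 (y - x)).
  rewrite !dotvE ?(dotvC y x).
  set M := mu / 2 * D; set N := (2 * mu * _)^-1; nra.
rewrite ler_norml; apply/andP; split; nra.
Qed.

Lemma gradient_moreau x p : prox x p ->
  gradient (moreau X lambda phi) x = lambda^-1 *: (x - p).
Proof.
move=> px; apply/rowP => i; rewrite mxE.
set C := (2 * lambda)^-1 + (2 * mu * lambda ^+ 2)^-1.
have dE (u : 'rV[R]_d) : dotv u (delta_mx 0 i) = u 0 i.
  rewrite /dotv (bigD1 i)//= mxE !eqxx mulr1 big1 ?addr0// => j ji.
  by rewrite mxE (negbTE ji) andbF mulr0.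
apply: (@quadratic_derive _ _ _ _ C) => h.
have := moreau_quadratic (h *: delta_mx 0 i + x) px.
rewrite -/C addrK dotvZr dE enorm_sqr dotvZl dotvZr dE !mxE !eqxx mulr1.
by rewrite -expr2.
Qed.

Lemma env_grad_normE x p : prox x p ->
  env_grad_norm X lambda phi x = lambda^-1 * enorm (x - p).
Proof.
move=> px; rewrite /env_grad_norm (gradient_moreau px) enormZ ger0_norm//.
by rewrite invr_ge0 ltW.
Qed.

Lemma env_grad_norm_sqr x p : prox x p ->
  enorm (p - x) ^+ 2 = lambda ^+ 2 * env_grad_norm X lambda phi x ^+ 2.
Proof.
by move=> px; rewrite (env_grad_normE px) -exprMn mulVKf ?gt_eqF// enormB.
Qed.

Lemma minval_le y : X y -> minval X phi <= phi y.
Proof. by case: has_min => xs h; rewrite (minval_argmin h); exact: h.2. Qed.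

(** At the proximal point [p] the gap splits into [phi p] minus the minimum of [phi], which is
    nonnegative, and [|p - x|^2 / (2 lambda)], which is [lambda / 2] times the squared gradient
    norm. *)
Lemma env_grad_norm_sqr_le_gap x :
  env_grad_norm X lambda phi x ^+ 2 <= 2 / lambda * envelope_gap X lambda phi x.
Proof.
have [p px] := prox_neq0 x; rewrite /envelope_gap (moreauE px).
rewrite (env_grad_norm_sqr px); have := minval_le px.1.
have -> : (2 * lambda)^-1 * (lambda ^+ 2 * env_grad_norm X lambda phi x ^+ 2) =
  lambda / 2 * env_grad_norm X lambda phi x ^+ 2 by field; rewrite gt_eqF.
set N := env_grad_norm _ _ _ _ ^+ 2; move=> h.
rewrite [leLHS](_ : _ = 2 / lambda * (lambda / 2 * N)); last by field; rewrite gt_eqF.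
by rewrite ler_pM2l ?divr_gt0//; lra.
Qed.

Lemma envelope_gap_ge0 x : 0 <= envelope_gap X lambda phi x.
Proof.
have := env_grad_norm_sqr_le_gap x.
have := sqr_ge0 (env_grad_norm X lambda phi x).
have : 0 < 2 / lambda by rewrite divr_gt0.
nra.
Qed.

(** Add the growth inequalities of the two proximal problems, each tested at the other's minimizer.
    The values of [phi] cancel, the squares reduce to [<p - q, x - y> / lambda], and Cauchy-Schwarz
    concludes. *)
Lemma prox_lipschitz x y p q : prox x p -> prox y q ->
  lambda * mu * enorm (p - q) <= enorm (x - y).
Proof.
move=> px qy.
have h1 := prox_growth px qy.1; rewrite (moreauE px) in h1.
have h2 := prox_growth qy px.1; rewrite (moreauE qy) -/mu in h2.
rewrite -/mu in h1.
have l0 : lambda != 0 by rewrite gt_eqF.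
have h : mu * enorm (p - q) ^+ 2 <= lambda^-1 * dotv (p - q) (x - y).
  have ilE : lambda^-1 = 2 * (2 * lambda)^-1 by field.
  move: h1 h2; rewrite ilE (enormB q p); set a := (2 * lambda)^-1.
  set D := enorm (p - q) ^+ 2.
  rewrite !enorm_sqr !dotvE ?(dotvC q p) ?(dotvC x p) ?(dotvC y q) ?(dotvC x q).
  rewrite ?(dotvC y p) ?(dotvC y x); lra.
have h' : lambda * mu * enorm (p - q) ^+ 2 <= enorm (p - q) * enorm (x - y).
  apply: le_trans (dotv_le_enorm _ _); move: h.
  by rewrite -(ler_pM2l lambda_gt0) !mulrA divff// mul1r.
have [->|n0] := eqVneq (enorm (p - q)) 0; first by rewrite mulr0 enorm_ge0.
have n_gt0 : 0 < enorm (p - q) by rewrite lt_neqAle eq_sym n0 enorm_ge0.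
by rewrite -(ler_pM2l n_gt0); nra.
Qed.

(** The gradient is [(x - p) / lambda], and the proximal map has Lipschitz constant
    [1 / (lambda mu)]. *)
Lemma env_grad_norm_lipschitz : exists2 L, 0 < L & forall x y,
  `|env_grad_norm X lambda phi x - env_grad_norm X lambda phi y| <=
    L * enorm (x - y).
Proof.
have il : 0 < lambda^-1 by rewrite invr_gt0.
have c_gt0 : 0 < lambda * mu by rewrite mulr_gt0.
exists (lambda^-1 * (1 + (lambda * mu)^-1)).
  by rewrite mulr_gt0// addr_gt0// invr_gt0.
move=> x y; have [p px] := prox_neq0 x; have [q qy] := prox_neq0 y.
rewrite (env_grad_normE px) (env_grad_normE qy) -mulrBr normrM (gtr0_norm il).
rewrite -mulrA ler_pM2l//; apply: le_trans (enorm_dist_le _ _) _.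
have -> : x - p - (y - q) = (x - y) + (q - p) 
  by rewrite opprB addrACA [RHS]addrACA (addrC (- p)).
apply: le_trans (enormD _ _) _; rewrite mulrDl mul1r lerD2l enormB.
by rewrite ler_pdivlMl//; exact: prox_lipschitz.
Qed.

End moreau_envelope.

(** * One step of the method *)

Section one_step.
Context {R : realType} {d : nat}.
Variables (X : set 'rV[R]_d) (f r : 'rV[R]_d -> R) (rho eta lambda : R).
Variable G : 'rV[R]_d -> set 'rV[R]_d.
Let phi := f \+ r.

Hypotheses (Xconvex : convex_set X).
Hypotheses (f_convex : modulus_convex X (- rho) f).
Hypotheses (r_convex : modulus_convex X (- eta) r).
Hypotheses (rho_ge0 : 0 <= rho) (eta_ge0 : 0 <= eta).
Hypotheses (lambda_gt0 : 0 < lambda) (lambda_lt : lambda * (rho + 2 * eta) < 1).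
Hypothesis prox_neq0 : forall x, prox X phi lambda x !=set0.
Hypothesis G_oracle : oracle X (wsubdiff X rho f) G.

Let phi_convex : modulus_convex X (- (rho + eta)) phi.
Proof. by rewrite opprD; exact: modulus_convexD. Qed.

Let lambda_lt' : lambda * (rho + eta) < 1.
Proof.
by apply: le_lt_trans lambda_lt; rewrite ler_pM2l// lerD2l; move: eta_ge0; lra.
Qed.

Lemma prox_subgrad_step_growth b x g xn y :
  prox_subgrad_step X r G b x g xn -> X y ->
  dotv g xn + r xn + (2 * b)^-1 * enorm (xn - x) ^+ 2 +
      (b^-1 - eta) / 2 * enorm (y - xn) ^+ 2 <=
    dotv g y + r y + (2 * b)^-1 * enorm (y - x) ^+ 2.
Proof.
move=> [b_gt0 _ xn_min] Xy.
have := modulus_convexD (modulus_convexD (@modulus_convex_dotv _ _ X g) r_convex)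
          (@modulus_convex_sqr _ _ X (2 * b)^-1 x).
have -> : 0 + - eta + 2 * (2 * b)^-1 = b^-1 - eta.
  by field; rewrite gt_eqF.
by move=> /(argmin_growth Xconvex)/(_ xn_min)/(_ _ Xy).
Qed.

(** Twice the growth of the step objective tested at [p], with [<g, p - x>] bounded by the weak
    subgradient inequality for [f] at [x]. The inner product left to control is [<g, x - xn>]. *)
Let descent b x g xn p :
  X x -> prox_subgrad_step X r G b x g xn -> X p ->
  (b^-1 - eta) * enorm (p - xn) ^+ 2 <=
    2 * (f p - f x) + rho * enorm (p - x) ^+ 2 + 2 * dotv g (x - xn) +
    2 * (r p - r xn) + b^-1 * (enorm (p - x) ^+ 2 - enorm (xn - x) ^+ 2).
Proof.
move=> Xx st Xp; have := prox_subgrad_step_growth st Xp.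
have [b_gt0 Gg _] := st.
have := wsubdiff_ineq ((G_oracle Xx).2 _ Gg) Xp.
have -> : (2 * b)^-1 = b^-1 / 2 by field; rewrite gt_eqF.
by rewrite !dotvE; nra.
Qed.

(** Turns an estimate of the distance to the proximal point, with error [Z], into one of the gap:
    [p] is a competitor in the problem at [xn], and [|p - x|^2] is [lambda^2] times the squared
    gradient norm. *)
Let envelope_le x xn p Z b : X xn -> prox X phi lambda x p ->
  enorm (p - xn) ^+ 2 <= enorm (p - x) ^+ 2 -
      b * (lambda^-1 - (rho + 2 * eta)) * enorm (p - x) ^+ 2 + Z ->
  envelope_gap X lambda phi xn <= envelope_gap X lambda phi x -
    (1 - lambda * (rho + 2 * eta)) * b / 2 *
      env_grad_norm X lambda phi x ^+ 2 + (2 * lambda)^-1 * Z.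
Proof.
move=> Xxn px; have l0 : lambda != 0 by rewrite gt_eqF.
have := moreau_le prox_neq0 xn px.1; rewrite /envelope_gap (moreauE px).
rewrite (env_grad_norm_sqr Xconvex phi_convex lambda_gt0 lambda_lt' prox_neq0 px).
move=> h h'.
have il : 0 < (2 * lambda)^-1 by rewrite invr_gt0 mulr_gt0.
move: h'; rewrite -(ler_pM2l il) => h'.
suff -> : (1 - lambda * (rho + 2 * eta)) * b / 2 *
    env_grad_norm X lambda phi x ^+ 2 =
    (2 * lambda)^-1 * (b * (lambda^-1 - (rho + 2 * eta)) *
      (lambda ^+ 2 * env_grad_norm X lambda phi x ^+ 2)) by lra.
by field.
Qed.

(** In [descent], [f x] is traded for [f xn] by a subgradient [g'] at [xn]. This produces
    [phi p - phi xn], bounded by testing the growth of the proximal problem at [xn]. Only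
    subgradients of [f] enter, and these are bounded by [L]. *)
Lemma step_recursion_bounded b x g xn L : X x ->
  prox_subgrad_step X r G b x g xn ->
  (forall y v, X y -> G y v -> enorm v <= L) ->
  b < (2 * (lambda^-1 + 2 * eta + rho))^-1 ->
  envelope_gap X lambda phi xn <= envelope_gap X lambda phi x -
    (1 - lambda * (rho + 2 * eta)) * b / 2 *
      env_grad_norm X lambda phi x ^+ 2 + 4 * L ^+ 2 / lambda * b ^+ 2.
Proof.
move=> Xx st GL b_lt; have [b_gt0 Gg [Xxn _]] := st.
have [p px] := prox_neq0 x; have [[g' Gg'] Gsub] := G_oracle Xxn.
have ibX Z : b * (b^-1 * Z) = Z by rewrite mulVKf// gt_eqF.
have il : 0 < lambda^-1 by rewrite invr_gt0.
have b_lt' : b^-1 >= 2 * (lambda^-1 + 2 * eta + rho).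
  have c_gt0 : 0 < 2 * (lambda^-1 + 2 * eta + rho).
    by move: rho_ge0 eta_ge0; lra.
  by rewrite -(mulr1 b^-1) -(ler_pM2l b_gt0) ibX -ler_pdivlMr// mul1r ltW.
have ilE : lambda * lambda^-1 = 1 by rewrite divff// gt_eqF.
have mu_ge0 : 0 <= lambda^-1 - (rho + 2 * eta).
  by rewrite subr_ge0 -(ler_pM2l lambda_gt0) ilE ltW.
have -> : 4 * L ^+ 2 / lambda * b ^+ 2 =
    (2 * lambda)^-1 * (8 * b ^+ 2 * L ^+ 2) by field; rewrite gt_eqF.
apply: (envelope_le Xxn px).
have H1 := descent Xx st px.1.
have H2 := wsubdiff_ineq (Gsub _ Gg') Xx.
have H3 := prox_growth Xconvex phi_convex lambda_gt0 px Xxn.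
rewrite (moreauE px) in H3.
have sqL v : G x v \/ G xn v -> dotv v v <= L ^+ 2.
  move=> h; rewrite -enorm_sqr lerXn2r ?nnegrE ?enorm_ge0//.
    by apply: le_trans (enorm_ge0 v) _; case: h; exact: GL.
  by case: h; exact: GL.
(* After rescaling, each product costs a quarter of [|xn - x|^2]; the step size bound leaves half of
   that square to pay for both. *)
have Y1 := dotv_young (4 * b) g (x - xn).
have Y2 := dotv_young (4 * b) (- g') (x - xn).
have := sqL _ (or_introl Gg); have := sqL _ (or_intror Gg').
rewrite dotvNl dotvNl dotvNr opprK -(enorm_sqr (x - xn)) in Y2.
rewrite -(enorm_sqr (x - xn)) in Y1.
rewrite (enormB x xn) in Y1 Y2 H2; rewrite (enormB xn p) in H3.
have il2 : (2 * lambda)^-1 = lambda^-1 / 2 by field; rewrite gt_eqF.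
rewrite il2 in H3.
move: H1 H2 H3 Y1 Y2; rewrite /phi/=.
have := sqr_ge0 (enorm (p - xn)); have := sqr_ge0 (enorm (p - x)).
have := sqr_ge0 (enorm (xn - x)).
set D := enorm (xn - x) ^+ 2; set P := enorm (p - x) ^+ 2.
set Q := enorm (p - xn) ^+ 2.
set e := dotv g _; set e' := dotv g' _; set n := dotv g g; set n' := dotv g' g'.
move=> D0 P0 Q0 H1 H2 H3 Y1 Y2 n'L nL.
have b2n : b ^+ 2 * n <= b ^+ 2 * L ^+ 2 by rewrite ler_wpM2l ?sqr_ge0.
have b2n' : b ^+ 2 * n' <= b ^+ 2 * L ^+ 2 by rewrite ler_wpM2l ?sqr_ge0.
have {}Y1 : 2 * b * e <= 4 * b ^+ 2 * L ^+ 2 + D / 4 by lra.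
have {}Y2 : - (2 * b * e') <= 4 * b ^+ 2 * L ^+ 2 + D / 4 by lra.
have K : (b^-1 - eta + (lambda^-1 - (rho + eta))) * Q <=
    (b^-1 - lambda^-1 + rho) * P + 2 * e - 2 * e' -
    (b^-1 - lambda^-1 - rho) * D by lra.
move: K; rewrite -(ler_pM2l b_gt0) => K.
have := ibX P; have := ibX Q; have := ibX D.
have := mulr_ge0 (mulr_ge0 (ltW b_gt0) eta_ge0) D0.
have := mulr_ge0 (mulr_ge0 (ltW b_gt0) eta_ge0) P0.
have := mulr_ge0 (mulr_ge0 (ltW b_gt0) mu_ge0) Q0.
have : b * (2 * (lambda^-1 + 2 * eta + rho) * D) <= b * (b^-1 * D).
  by rewrite ler_pM2l// ler_wpM2r.
lra.
Qed.

(** A subgradient [h] of [r] at [x] compares [r xn] with [r x], and the proximal growth is tested at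
    [x] itself. The linear terms then involve only [g + h], which [S] controls. *)
Lemma step_recursion_bounded_sum b x g xn h S : X x ->
  prox_subgrad_step X r G b x g xn -> wsubdiff X eta r x h ->
  enorm (g + h) ^+ 2 <= S -> 6 * eta * b < 1 ->
  envelope_gap X lambda phi xn <= envelope_gap X lambda phi x -
    (1 - lambda * (rho + 2 * eta)) * b / 2 *
      env_grad_norm X lambda phi x ^+ 2 + 6 / (5 * lambda) * S * b ^+ 2.
Proof.
move=> Xx st hh hS b_lt; have [b_gt0 Gg [Xxn _]] := st.
have [p px] := prox_neq0 x.
have ibX Z : b * (b^-1 * Z) = Z by rewrite mulVKf// gt_eqF.
have ilE : lambda * lambda^-1 = 1 by rewrite divff// gt_eqF.
have mu_ge0 : 0 <= lambda^-1 - (rho + 2 * eta).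
  by rewrite subr_ge0 -(ler_pM2l lambda_gt0) ilE ltW.
have -> : 6 / (5 * lambda) * S * b ^+ 2 =
    (2 * lambda)^-1 * (12 / 5 * b ^+ 2 * S) by field; rewrite gt_eqF.
apply: (envelope_le Xxn px).
have H1 := descent Xx st px.1.
have H2 := wsubdiff_ineq hh Xxn.
have H3 := prox_growth Xconvex phi_convex lambda_gt0 px Xx.
rewrite (moreauE px) subrr in H3.
have e0 : enorm (0 : 'rV[R]_d) ^+ 2 = 0 by rewrite enorm_sqr dotv0l.
rewrite e0 mulr0 addr0 (enormB x p) in H3.
have il2 : (2 * lambda)^-1 = lambda^-1 / 2 by field; rewrite gt_eqF.
rewrite il2 in H3.
(* Here [1 - eta * b >= 5 / 6] because of the step size bound. *)
have Y := dotv_young (6 / 5 * b) (g + h) (x - xn).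
rewrite -!enorm_sqr in Y.
have hD : dotv h (xn - x) = - dotv h (x - xn) by rewrite -opprB dotvNr.
rewrite (enormB x xn) dotvDl in Y; rewrite hD in H2.
move: H1 H2 H3 Y; rewrite /phi/=.
have := sqr_ge0 (enorm (p - xn)); have := sqr_ge0 (enorm (p - x)).
have := sqr_ge0 (enorm (xn - x)).
set D := enorm (xn - x) ^+ 2; set P := enorm (p - x) ^+ 2.
set Q := enorm (p - xn) ^+ 2; set n := enorm (g + h) ^+ 2 in hS *.
set e := dotv g _; set e' := dotv h _.
move=> D0 P0 Q0 H1 H2 H3 Y.
have b2n : b ^+ 2 * n <= b ^+ 2 * S by rewrite ler_wpM2l ?sqr_ge0.
have {}Y : 2 * b * (e + e') <= 6 / 5 * b ^+ 2 * S + 5 / 6 * D by lra.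
have K : (b^-1 - eta) * Q <=
    (b^-1 - eta) * P - 2 * (lambda^-1 - (rho + eta)) * P + 2 * (e + e') -
    (b^-1 - eta) * D by lra.
have {}K : (1 - b * eta) * Q <= (1 - b * eta) * P -
    2 * (b * (lambda^-1 - (rho + eta))) * P + 6 / 5 * b ^+ 2 * S.
  move: K; rewrite -(ler_pM2l b_gt0) => K.
  have := ibX P; have := ibX Q; have := ibX D.
  have := ler_wpM2r D0 (ltW b_lt); lra.
have S0 : 0 <= S by apply: le_trans hS; exact: sqr_ge0.
have m0 : 0 <= b * (lambda^-1 - (rho + 2 * eta)) * P.
  exact: (mulr_ge0 (mulr_ge0 (ltW b_gt0) mu_ge0) P0).
have bS0 : 0 <= b ^+ 2 * S by rewrite mulr_ge0 ?sqr_ge0.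
have be0 : 0 <= b * eta := mulr_ge0 (ltW b_gt0) eta_ge0.
have beP0 : 0 <= b * eta * P := mulr_ge0 be0 P0.
have ilP0 : 0 <= b * lambda^-1 * P.
  by apply: mulr_ge0 => //; apply: mulr_ge0; rewrite ltW// invr_gt0.
have t_gt0 : 0 < 1 - b * eta by lra.
have h1 := mulr_ge0 be0 m0.
have h2 : b * eta * (b ^+ 2 * S) <= 1 / 6 * (b ^+ 2 * S).
  by rewrite ler_wpM2r//; lra.
(* The goal allows the error [12 / 5], twice the [6 / 5] in [K]; this covers the factor
   [1 - b * eta], which exceeds [5 / 6]. *)
rewrite -(ler_pM2l t_gt0); apply: le_trans K _.
lra.
Qed.

(** The growth of the step objective tested at [x], added to the subgradient inequality for [r],
    gives [(1 / b - eta) |x - xn|^2 <= |g + h| |x - xn|]. Since [eta * b < 1 / 6], the factor 2 is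
    enough. *)
Lemma step_length b x g xn h : X x ->
  prox_subgrad_step X r G b x g xn -> wsubdiff X eta r x h ->
  6 * eta * b < 1 -> enorm (x - xn) <= 2 * enorm (g + h) * b.
Proof.
move=> Xx st hh b_lt; have [b_gt0 Gg [Xxn _]] := st.
have H1 := prox_subgrad_step_growth st Xx; have H2 := wsubdiff_ineq hh Xxn.
have ibX Z : b * (b^-1 * Z) = Z by rewrite mulVKf// gt_eqF.
have e0 : enorm (0 : 'rV[R]_d) ^+ 2 = 0 by rewrite enorm_sqr dotv0l.
rewrite subrr e0 mulr0 addr0 (enormB xn x) in H1.
rewrite (enormB xn x) in H2.
have := dotv_le_enorm (g + h) (x - xn).
move: H1 H2; have -> : (2 * b)^-1 = b^-1 / 2 by field; rewrite gt_eqF.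
rewrite !dotvE => H1 H2 CS.
have D0 := enorm_ge0 (x - xn); have N0 := enorm_ge0 (g + h).
set D := enorm (x - xn) in D0 H1 H2 CS *; set N := enorm (g + h) in N0 CS *.
have : (b^-1 - eta) * D ^+ 2 <= N * D by lra.
rewrite -(ler_pM2l b_gt0) => h1.
have [->|Dn0] := eqVneq D 0.
  by rewrite mulr_ge0 ?(ltW b_gt0)// mulr_ge0.
have D_gt0 : 0 < D by rewrite lt_neqAle eq_sym Dn0.
rewrite -(ler_pM2l D_gt0).
have : eta * b * D ^+ 2 <= 1 / 6 * D ^+ 2.
  by rewrite ler_wpM2r ?sqr_ge0//; lra.
have := mulr_ge0 (mulr_ge0 (ltW b_gt0) N0) D0.
have := ibX (D ^+ 2); lra.
Qed.

End one_step.

(** * Real recursions *)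

Section recursions.
Context {R : realType}.
Implicit Types (u w a : nat -> R).

(** The bound [1 + t <= expR t] collects the factors into one exponential; the additive errors may
    be multiplied by it because it is at least 1. *)
Lemma discrete_gronwall u w (c1 c2 : R) n : 0 <= c1 -> 0 <= c2 ->
  (forall k, 0 <= w k) -> (forall k, 0 <= u k) ->
  (forall k, (k < n)%N -> u k.+1 <= (1 + c1 * w k) * u k + c2 * w k) ->
  u n <= expR (c1 * series w n) * (u 0%N + c2 * series w n).
Proof.
move=> c1_ge0 c2_ge0 w_ge0 u_ge0 rec.
have sw_ge0 k : 0 <= series w k by apply: sumr_ge0 => i _.
suff : forall k, (k <= n)%N ->
    u k <= expR (c1 * series w k) * (u 0%N + c2 * series w k) by exact.
elim=> [_|k IH kn]; first by rewrite /series/= big_geq// !mulr0 expR0 addr0 mul1r.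
apply: le_trans (rec _ kn) _; rewrite seriesSr (mulrDr c1) expRD.
have := IH (ltnW kn); have := expR_ge1Dx (c1 * w k).
have cs : 0 <= c1 * series w k by rewrite mulr_ge0.
have cw : 0 <= c1 * w k by rewrite mulr_ge0.
have e1 : 1 <= expR (c1 * series w k) by rewrite -expR0 ler_expR.
have e2 : 1 <= expR (c1 * w k) by rewrite -expR0 ler_expR.
set E := expR _ in e1 *; set E' := expR (c1 * w k) in e2 *.
set B := u 0%N + _ => hE' hu.
have B_ge0 : 0 <= B by rewrite addr_ge0// mulr_ge0.
have c2w : 0 <= c2 * w k by rewrite mulr_ge0.
have -> : u 0%N + c2 * (series w k + w k) = B + c2 * w k by rewrite /B; ring.
have h1 : (1 + c1 * w k) * u k <= E' * (E * B).
  by apply: ler_pM => //; rewrite addr_ge0.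
have h2 : c2 * w k <= E * E' * (c2 * w k).
  by rewrite ler_peMl// -[1]mulr1 ler_pM.
lra.
Qed.

Lemma ge_bigmin_nat (x0 : R) a n k : (k < n)%N ->
  \big[Num.min/x0]_(0 <= i < n) a i <= a k.
Proof.
move=> kn; rewrite big_mkord.
exact: (bigmin_le x0 (Ordinal kn) (fun i : 'I_n => a i)).
Qed.

(** Replace each [N2 k] by the minimum and sum: the differences of [u] telescope, and [u T.+1 >= 0]
    is dropped. *)
Lemma min_le_telescope u w a N2 (x0 c c3 : R) T : 0 < c ->
  0 <= u T.+1 -> (forall k, (k <= T)%N -> 0 < a k) ->
  (forall k, (k <= T)%N -> c * a k / 2 * N2 k <= u k - u k.+1 + c3 * w k) ->
  \big[Num.min/x0]_(0 <= k < T.+1) N2 k <=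
    2 / c * ((u 0%N + c3 * \sum_(0 <= k < T.+1) w k) /
       \sum_(0 <= k < T.+1) a k).
Proof.
move=> c_gt0 u_ge0 a_gt0 rec; set m := \big[_/_]_(_ <= _ < _) _.
have A_gt0 : 0 < \sum_(0 <= k < T.+1) a k.
  rewrite big_nat_recr//= ltr_wpDl ?a_gt0// big_nat.
  by apply: sumr_ge0 => k /andP[_ kT]; rewrite ltW// a_gt0// ltnW.
rewrite mulrA ler_pdivlMr// mulrAC ler_pdivlMr//.
suff h n : (n <= T.+1)%N -> c * (\sum_(0 <= k < n) a k) * m <=
    2 * (u 0%N - u n + c3 * \sum_(0 <= k < n) w k).
  by have := h _ (leqnn _); set A := \sum_(_ <= _ < _) _; lra.
elim: n => [_|n IH nT]; first by rewrite !big_geq// subrr; lra.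
have := IH (ltnW nT); have := rec n nT; rewrite !big_nat_recr//=.
have : c * a n * m <= c * a n * N2 n.
  by rewrite ler_pM2l ?ge_bigmin_nat// mulr_gt0 ?a_gt0.
lra.
Qed.

(* If [u m] is large, then [u] stays above [e] until it first falls below [e]
   at some [n], because [a] has divergent sum; the sum of [a] over this block is
   at most [e^-2] times a tail of the convergent series, and [u] moves by at
   most [C] times that sum. *)
Lemma cvg0_of_summable_sqr u a (C : R) : 0 < C ->
  (forall k, 0 < a k) -> (forall k, 0 <= u k) ->
  (forall k, `|u k - u k.+1| <= C * a k) ->
  series a @ \oo --> +oo -> cvgn (series (fun k => a k * u k ^+ 2)) ->
  u @ \oo --> (0 : R).
Proof.
move=> C_gt0 a_gt0 u_ge0 uC a_oo S_cvg; set S := series _ in S_cvg.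
have S_nd : nondecreasing_seq S.
  by apply: nondecreasing_series => k _ _; rewrite mulr_ge0 ?sqr_ge0 ?ltW.
apply/cvgrPdist_le => eps eps_gt0; pose e := eps / 2.
have e_gt0 : 0 < e by rewrite divr_gt0.
(* A tail of this size allows [u] to move by at most [C * (e^3 / C) / e^2 = e], hence
   [u m < 2 e = eps]. *)
have eta_gt0 : 0 < e ^+ 3 / C by rewrite divr_gt0 ?exprn_gt0.
have := (cvgrPdist_le _ _).1 S_cvg _ eta_gt0; rewrite /= => -[N _ SN].
exists N => // m /= Nm; rewrite sub0r normrN ger0_norm//.
have tail n : S n - S m <= e ^+ 3 / C.
  have := SN m Nm; rewrite /= ler_norml => /andP[_].
  have := nondecreasing_cvgn_le S_nd S_cvg n; lra.
have block j : (forall i, (i < j)%N -> e <= u (m + i)%N) ->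
    e ^+ 2 * (series a (m + j)%N - series a m) <= S (m + j)%N - S m.
  elim: j => [_|j IH hj]; first by rewrite addn0 !subrr mulr0.
  have := IH (fun i ij => hj i (ltnW ij)).
  rewrite addnS /S !seriesSr -/S; have := hj j (ltnSn _).
  have := a_gt0 (m + j)%N; set v := u _; set t := a _ => t_gt0 ev.
  have : t * e ^+ 2 <= t * v ^+ 2.
    by rewrite ler_pM2l// lerXn2r// nnegrE ltW// (lt_le_trans e_gt0).
  lra.
have move_le j : u m - u (m + j)%N <= C * (series a (m + j)%N - series a m).
  elim: j => [|j IH]; first by rewrite addn0 !subrr mulr0.
  rewrite addnS seriesSr.
  have := uC (m + j)%N; rewrite ler_norml => /andP[_]; lra.
have [j0 uj0] : exists j, u (m + j)%N < e.
  apply: contrapT => /forallNP nlt.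
  have ge_e i : e <= u (m + i)%N by rewrite leNgt; apply/negP/nlt.
  (* If [u] never fell below [e], [block] would bound the sum of [a] beyond [m] by
     [(e^3 / C) / e^2], while divergence makes it exceed this by 1. *)
  pose B := series a m + (e ^+ 3 / C) / e ^+ 2 + 1.
  have [n1 _ hn1] := (cvgryPge _).1 a_oo B.
  have := hn1 (m + n1)%N (leq_addl _ _); rewrite /= /B.
  have := block n1 (fun i _ => ge_e i); have := tail (m + n1)%N.
  set A := series a _; set A' := series a _; set D := e ^+ 3 / C.
  move=> h1 h2; have : A - A' <= D / e ^+ 2.
    by rewrite ler_pdivlMr ?exprn_gt0// mulrC; lra.
  lra.
have exj : exists j, u (m + j)%N < e by exists j0.
case: (ex_minnP exj) => j uj jmin.
have hj i : (i < j)%N -> e <= u (m + i)%N.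
  by move=> ij; rewrite leNgt; apply/negP => /jmin; rewrite leqNgt ij.
have := block j hj; have := move_le j; have := tail (m + j)%N.
set A := series a _ - series a _; move=> h1 h2 h3.
have : e ^+ 2 * (C * A) <= e ^+ 2 * e.
  have -> : e ^+ 2 * e = C * (e ^+ 3 / C) by field; rewrite gt_eqF.
  by rewrite mulrCA ler_pM2l//; lra.
rewrite ler_pM2l ?exprn_gt0//; rewrite /e in uj *; lra.
Qed.

End recursions.

(** * Runs of the method *)

Section prox_subgradient.
Context {R : realType} {d : nat}.
Variables (X : set 'rV[R]_d) (f r : 'rV[R]_d -> R) (rho eta lambda : R).
Variables G H : 'rV[R]_d -> set 'rV[R]_d.
Let phi := f \+ r.
Hypotheses (Xclosed : closed X) (Xconvex : convex_set X).
Hypotheses (f_lsc : lsc_on X f) (r_lsc : lsc_on X r).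
Hypothesis has_min : argmin X phi !=set0.
Hypotheses (rho_ge0 : 0 <= rho) (eta_ge0 : 0 <= eta).
Hypotheses (f_wconvex : weakly_convex X rho f) (r_wconvex : weakly_convex X eta r).
Hypotheses (lambda_gt0 : 0 < lambda) (lambda_lt : lt_recip lambda (rho + 2 * eta)).
Hypothesis G_oracle : oracle X (wsubdiff X rho f) G.

Local Notation gap := (envelope_gap X lambda phi).
Local Notation grad := (env_grad_norm X lambda phi).
Let kappa := 1 - lambda * (rho + 2 * eta).

Lemma lt_recipP (x y : R) : 0 <= y -> lt_recip x y -> y * x < 1.
Proof.
rewrite le_eqVlt => /predU1P[<- _|y_gt0 /(_ y_gt0)]; first by rewrite mul0r.
by rewrite -(ltr_pM2l y_gt0) divff// gt_eqF.
Qed.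

Let lambda_lt1 : lambda * (rho + 2 * eta) < 1.
Proof. by rewrite mulrC lt_recipP// addr_ge0// mulr_ge0. Qed.

Lemma kappa_gt0 : 0 < kappa.
Proof. by rewrite subr_gt0. Qed.

Let lambda_lt2 : lambda * (rho + eta) < 1.
Proof.
by apply: le_lt_trans lambda_lt1; rewrite ler_pM2l// lerD2l; move: eta_ge0; lra.
Qed.

Let f_convex := weakly_convex_modulus f_wconvex.
Let r_convex := weakly_convex_modulus r_wconvex.

Let phi_convex : modulus_convex X (- (rho + eta)) phi.
Proof. by rewrite opprD; exact: modulus_convexD. Qed.

Lemma prox_sum_neq0 x : prox X phi lambda x !=set0.
Proof.
apply: prox_exists => //; last by rewrite invr_gt0 mulr_gt0.
by apply: lsc_withinD; exact: lsc_onW.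
Qed.

Lemma gap_ge0 x : 0 <= gap x.
Proof. exact: (envelope_gap_ge0 Xconvex phi_convex lambda_gt0 lambda_lt2 prox_sum_neq0 has_min). Qed.

(** Apply [env_grad_norm_sqr_le_gap] under the square root. This reduces the existence of the
    recursion and the limit under [Cond4] to [Cond3]. *)
Lemma Cond4_Cond3 c5 c6 :
  condition_holds X f r eta lambda G H (Cond4 c5 c6) ->
  condition_holds X f r eta lambda G H (Cond3 (2 * c5 / lambda) c6).
Proof.
move=> [c5_ge0 c6_ge0 Ho hB]; split=> //.
  by rewrite !mulr_ge0// invr_ge0 ltW.
move=> x g h Xx Gg Hh; apply: le_trans (hB _ _ _ Xx Gg Hh) _.
apply: ler_wsqrtr; rewrite lerD2r.
have -> : 2 * c5 / lambda * gap x = c5 * (2 / lambda * gap x) by ring.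
rewrite ler_wpM2l//.
exact: (env_grad_norm_sqr_le_gap Xconvex phi_convex lambda_gt0 lambda_lt2 prox_sum_neq0 has_min).
Qed.

(** The constants are uniform over points and step sizes, so one pair serves both the given run and
    all runs with constant step size. *)
Definition one_step_recursion (C : condition R) (c1 c2 : R) :=
  forall b x g xn, X x -> prox_subgrad_step X r G b x g xn ->
    step_bound rho eta lambda C b ->
    gap xn - (1 + c1 * b ^+ 2) * gap x <=
      - (kappa * b / 2 * grad x ^+ 2) + c2 * b ^+ 2.

Lemma one_step_recursion_exists C :
  condition_holds X f r eta lambda G H C ->
  exists c1 c2, [/\ 0 < c1, 0 <= c2 & one_step_recursion C c1 c2].
Proof.
suff cond3 a3 a4 : condition_holds X f r eta lambda G H (Cond3 a3 a4) ->
    exists c1 c2, [/\ 0 < c1, 0 <= c2 & one_step_recursion (Cond3 a3 a4) c1 c2].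
  case: C => [L|a3 a4|c5 c6]; [|exact: cond3|by move=> /Cond4_Cond3/cond3].
  (* The one-step bound has no growth term here; as the gap is nonnegative, a positive [c1] may be
     inserted. *)
  move=> hL; exists 1, (4 * L ^+ 2 / lambda).
  split=> //; first by rewrite divr_ge0 ?(ltW lambda_gt0)// mulr_ge0 ?sqr_ge0.
  move=> b x g xn Xx st bb.
  have := step_recursion_bounded Xconvex f_convex r_convex rho_ge0 eta_ge0
    lambda_gt0 lambda_lt1 prox_sum_neq0 G_oracle Xx st hL bb.
  have := mulr_ge0 (sqr_ge0 b) (gap_ge0 x); rewrite /kappa; lra.
move=> [a3_ge0 a4_ge0 Ho hB].
pose c := 6 / (5 * lambda).
have c_gt0 : 0 < c by rewrite divr_gt0// mulr_gt0.
(* The bound [a3 * gap x + a4] splits: its first part feeds [c1], its second [c2]. Adding 1 keeps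
   [c1] positive when [a3 = 0]. *)
exists (c * a3 + 1), (c * a4); split.
- by rewrite ltr_wpDl// mulr_ge0// ltW.
- by rewrite mulr_ge0// ltW.
move=> b x g xn Xx st bb; have [[h Hh] Hsub] := Ho _ Xx.
have [b_gt0 Gg _] := st.
have hS : enorm (g + h) ^+ 2 <= a3 * gap x + a4.
  have S_ge0 : 0 <= a3 * gap x + a4 by rewrite addr_ge0// mulr_ge0// gap_ge0.
  rewrite -(sqr_sqrtr S_ge0) lerXn2r ?nnegrE ?enorm_ge0 ?sqrtr_ge0//.
  exact: hB.
have b_lt : 6 * eta * b < 1 by apply: lt_recipP => //; rewrite mulr_ge0.
have := step_recursion_bounded_sum Xconvex f_convex r_convex eta_ge0
  lambda_gt0 lambda_lt1 prox_sum_neq0 G_oracle Xx st (Hsub _ Hh) hS b_lt.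
rewrite -/c /kappa.
have := mulr_ge0 (sqr_ge0 b) (gap_ge0 x); lra.
Qed.

Lemma prox_subgrad_in alpha x g :
  prox_subgrad X r G alpha x g -> forall k, X (x k).
Proof. by move=> [X0 st] [|k] //; have [_ _ []] := st k. Qed.

(* The recursion is only assumed up to time [n]: in a run with constant step
   size only finitely many steps are specified. *)
Lemma gap_bounded (z : nat -> 'rV[R]_d) b (c1 c2 B : R) n :
  0 <= c1 -> 0 <= c2 ->
  (forall k, (k < n)%N -> 0 < b k) ->
  (forall k, (k < n)%N -> gap (z k.+1) - (1 + c1 * b k ^+ 2) * gap (z k) <=
     - (kappa * b k / 2 * grad (z k) ^+ 2) + c2 * b k ^+ 2) ->
  series (fun k => b k ^+ 2) n <= B ->
  gap (z n) <= expR (c1 * B) * (gap (z 0%N) + c2 * B).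
Proof.
move=> c1_ge0 c2_ge0 b_gt0 rec sB.
have := @discrete_gronwall _ (gap \o z) (fun k => b k ^+ 2) c1 c2 n c1_ge0 c2_ge0.
move=> /(_ (fun k => sqr_ge0 _) (fun k => gap_ge0 _)) h.
apply: le_trans (h _) _ => [k kn /=|].
  have := rec k kn; have := sqr_ge0 (grad (z k)).
  have := mulr_gt0 kappa_gt0 (b_gt0 k kn).
  move=> t_gt0 g2; have := mulr_ge0 (ltW t_gt0) g2; lra.
have s_ge0 : 0 <= series (fun k => b k ^+ 2) n.
  by apply: sumr_ge0 => i _; exact: sqr_ge0.
apply: ler_pM => //=.
- by rewrite addr_ge0 ?gap_ge0// mulr_ge0.
- by rewrite ler_expR ler_wpM2l.
- by rewrite lerD2l ler_wpM2l.
Qed.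

(** * A run whose step sizes form a sigma-sequence *)

Section run.
Variables (C : condition R) (alpha beta : nat -> R) (x g : nat -> 'rV[R]_d).
Hypothesis beta_sigma : sigma_sequence beta.
Hypothesis alpha_beta : forall k, alpha k = beta k.
Hypothesis x_run : prox_subgrad X r G alpha x g.

Let beta_gt0 k : 0 < beta k.
Proof. by case: beta_sigma. Qed.

Let sum_sqr_beta_bounded : exists B, forall n, series (fun k => beta k ^+ 2) n <= B.
Proof.
case: beta_sigma => _ _ cv; exists (limn (series (fun k => beta k ^+ 2))) => n.
apply: nondecreasing_cvgn_le => //.
by apply: nondecreasing_series => k _ _; exact: sqr_ge0.
Qed.

(** Boundedness of the gap along the run is what makes a finite [gamma3] exist. *)
Lemma gap_bounded_run c1 c2 : 0 <= c1 -> 0 <= c2 ->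
  envelope_recursion X phi rho eta lambda alpha beta x c1 c2 ->
  exists K, forall k, gap (x k) <= K.
Proof.
move=> c1_ge0 c2_ge0 rec; have [B sB] := sum_sqr_beta_bounded.
exists (expR (c1 * B) * (gap (x 0%N) + c2 * B)) => n.
apply: (@gap_bounded x beta) => // k _.
by have := rec k; rewrite alpha_beta.
Qed.

(** The growth term [c1 * gap (x k)] is absorbed into [c3], so that the gaps telescope. *)
Lemma recursion_telescope c1 c2 c3 :
  envelope_recursion X phi rho eta lambda alpha beta x c1 c2 ->
  gamma3_bound X phi lambda x c1 c2 c3 ->
  forall k, kappa * alpha k / 2 * grad (x k) ^+ 2 <=
    gap (x k) - gap (x k.+1) + c3 * beta k ^+ 2.
Proof.
move=> rec c3P k; have := rec k.
have := ler_wpM2r (sqr_ge0 (beta k)) (c3P k); rewrite /kappa; lra.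
Qed.

Lemma min_grad_sq_le c1 c2 c3 T :
  envelope_recursion X phi rho eta lambda alpha beta x c1 c2 ->
  gamma3_bound X phi lambda x c1 c2 c3 ->
  min_grad_sq X phi lambda x T <=
    2 / kappa * ((gap (x 0%N) + c3 * \sum_(0 <= k < T.+1) beta k ^+ 2) /
      \sum_(0 <= k < T.+1) alpha k).
Proof.
move=> rec c3P.
apply: (@min_le_telescope _ (gap \o x) (fun k => beta k ^+ 2) alpha
  (fun k => grad (x k) ^+ 2)) => [|/=|k _|k _].
- exact: kappa_gt0.
- exact: gap_ge0.
- by rewrite alpha_beta.
- exact: recursion_telescope rec c3P k.
Qed.

(** The inequality defining [gamma3] gives [gap (x k) <= c3 / c1], so [Cond3] yields the first entry
    of the maximum. *)
Lemma subgradient_sum_le_M1 a3 a4 c1 c2 c3 c5 c6 k h :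
  condition_holds X f r eta lambda G H (Cond3 a3 a4) ->
  0 < c1 -> 0 <= c2 -> gamma3_bound X phi lambda x c1 c2 c3 ->
  H (x k) h -> enorm (g k + h) <= M1 lambda c1 c3 a3 a4 c5 c6.
Proof.
move=> [a3_ge0 a4_ge0 _ hB] c1_gt0 c2_ge0 c3P Hh.
have [_ Gg _] := x_run.2 k.
apply: le_trans (hB _ _ _ (prox_subgrad_in x_run k) Gg Hh) _.
rewrite /M1 le_max; apply/orP; left; apply: ler_wsqrtr.
rewrite lerD2r -mulrA ler_wpM2l// ler_pdivlMr// mulrC.
by have := c3P k; lra.
Qed.

Lemma run_step_length a3 a4 k h M :
  condition_holds X f r eta lambda G H (Cond3 a3 a4) ->
  (forall k, step_bound rho eta lambda (Cond3 a3 a4) (beta k)) ->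
  H (x k) h -> enorm (g k + h) <= M ->
  enorm (x k - x k.+1) <= 2 * M * alpha k.
Proof.
move=> [_ _ Ho _] bb Hh hM.
have Xx := prox_subgrad_in x_run k.
apply: le_trans (step_length Xconvex r_convex Xx (x_run.2 k)
  ((Ho _ Xx).2 _ Hh) _) _.
  by rewrite alpha_beta; apply: lt_recipP; [rewrite mulr_ge0|exact: bb].
by rewrite alpha_beta ler_pM2r// ler_pM2l.
Qed.

Lemma env_grad_norm_cvg0 a3 a4 :
  condition_holds X f r eta lambda G H (Cond3 a3 a4) ->
  (forall k, step_bound rho eta lambda (Cond3 a3 a4) (beta k)) ->
  grad (x k) @[k --> \oo] --> (0 : R).
Proof.
move=> hC bb; have [c1 [c2 [c1_gt0 c2_ge0 one]]] := one_step_recursion_exists hC.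
have rec : envelope_recursion X phi rho eta lambda alpha beta x c1 c2.
  move=> k; have := x_run.2 k; rewrite alpha_beta => st.
  exact: one (prox_subgrad_in x_run k) st (bb k).
have [K gapK] := gap_bounded_run (ltW c1_gt0) c2_ge0 rec.
have c3P : gamma3_bound X phi lambda x c1 c2 (c1 * K + c2).
  by move=> k; rewrite lerD2r ler_pM2l.
have [L L_gt0 gradL] := env_grad_norm_lipschitz Xconvex phi_convex lambda_gt0
  lambda_lt2 prox_sum_neq0.
(* The bound comes from the first entry of the maximum, so the constants of the second are set to
   0. *)
set M := M1 lambda c1 (c1 * K + c2) a3 a4 0 0.
have M_ge0 : 0 <= M by rewrite /M /M1 le_max sqrtr_ge0.
(* Adding 1 keeps the constant positive when [M = 0]. *)
have L_gt0' : 0 < L * (2 * M) + 1 by rewrite ltr_wpDl// !mulr_ge0// ltW.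
have [_ beta_oo _] := beta_sigma.
apply: (cvg0_of_summable_sqr L_gt0' beta_gt0 _ _ beta_oo).
- by move=> k; exact: enorm_ge0.
- move=> k; apply: le_trans (gradL _ _) _.
  have [_ _ Ho _] := hC.
  have [[h Hh] _] := Ho _ (prox_subgrad_in x_run k).
  have hM := subgradient_sum_le_M1 0 0 hC c1_gt0 c2_ge0 c3P Hh.
  have := run_step_length hC bb Hh hM; rewrite -/M alpha_beta => h1.
  apply: le_trans (ler_wpM2l (ltW L_gt0) h1) _.
  have := beta_gt0 k; lra.
(* Telescoping bounds the partial sums of this series of nonnegative terms. *)
- apply: nondecreasing_is_cvgn.
    by apply: nondecreasing_series => k _ _; rewrite mulr_ge0 ?sqr_ge0// ltW.
  have [B sB] := sum_sqr_beta_bounded.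
  exists (2 / kappa * (gap (x 0%N) + (c1 * K + c2) * B)) => _ [n _ <-].
  have c3_ge0 : 0 <= c1 * K + c2.
    rewrite addr_ge0// mulr_ge0 ?(ltW c1_gt0)//.
    exact: le_trans (gap_ge0 (x 0%N)) (gapK _).
  rewrite mulrAC ler_pdivlMr ?kappa_gt0//.
  suff : series (fun k => beta k * grad (x k) ^+ 2) n * kappa <=
      2 * (gap (x 0%N) - gap (x n) +
           (c1 * K + c2) * series (fun k => beta k ^+ 2) n).
    by have := ler_wpM2l c3_ge0 (sB n); have := gap_ge0 (x n); lra.
  elim: n => [|n IH]; first by rewrite /series/= !big_geq// subrr; lra.
  have := recursion_telescope rec c3P n; rewrite alpha_beta !seriesSr; lra.
Qed.

End run.

(** The squared step sizes up to [T] sum to [Delta^2] for every [T], so the bound [K] on the gap,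
    and with it [c3], does not depend on the horizon. The step sizes sum to [Delta] times the root
    of [T + 1], which gives the rate. *)
Lemma constant_step_rate C x0 Delta : X x0 ->
  condition_holds X f r eta lambda G H C -> 0 < Delta ->
  exists R1, 0 < R1 /\
    forall (T : nat) (b : nat -> R) (z gz : nat -> 'rV[R]_d),
      (forall k, (k <= T)%N -> b k = Delta / Num.sqrt T.+1%:R) ->
      (forall k, (k <= T)%N -> step_bound rho eta lambda C (b k)) ->
      z 0%N = x0 ->
      (forall k, (k <= T)%N ->
         prox_subgrad_step X r G (b k) (z k) (gz k) (z k.+1)) ->
      min_grad_sq X phi lambda z T <= R1 / Num.sqrt T.+1%:R.
Proof.
move=> Xx0 hC D_gt0.
have [c1 [c2 [c1_gt0 c2_ge0 one]]] := one_step_recursion_exists hC.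
pose K := expR (c1 * Delta ^+ 2) * (gap x0 + c2 * Delta ^+ 2).
have K_ge0 : 0 <= K.
  by rewrite mulr_ge0 ?expR_ge0// addr_ge0 ?gap_ge0// mulr_ge0 ?sqr_ge0.
pose c3 := c1 * K + c2.
have c3_ge0 : 0 <= c3 by rewrite addr_ge0// mulr_ge0// ltW.
(* The summand 1 keeps the constant positive when the first term vanishes. *)
exists (2 / kappa * ((gap x0 + c3 * Delta ^+ 2) / Delta) + 1); split.
  rewrite ltr_wpDl// mulr_ge0 ?divr_ge0 ?(ltW kappa_gt0) ?(ltW D_gt0)//.
  by rewrite addr_ge0 ?gap_ge0// mulr_ge0 ?sqr_ge0.
move=> T b z gz bE bb z0 st.
set q := Num.sqrt T.+1%:R in bE *.
have q_gt0 : 0 < q by rewrite sqrtr_gt0 ltr0n.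
have qE : q ^+ 2 = T.+1%:R by rewrite sqr_sqrtr// ler0n.
have b_gt0 k : (k <= T)%N -> 0 < b k by move=> kT; rewrite bE// divr_gt0.
have Xz k : (k <= T.+1)%N -> X (z k).
  by case: k => [_|k kT]; [rewrite z0|have [_ _ []] := st k kT].
have sb n : (n <= T.+1)%N ->
    series (fun k => b k ^+ 2) n = n%:R * (Delta / q) ^+ 2.
  move=> nT; rewrite /series/= big_nat.
  under eq_bigr => k /andP[_ kn] do rewrite bE -1?ltnS ?(leq_trans kn)//.
  by rewrite -big_nat sumr_const_nat subn0 mulr_natl.
have sbT : series (fun k => b k ^+ 2) T.+1 = Delta ^+ 2.
  by rewrite sb// -qE exprMn exprVn mulrCA divff ?mulr1// expf_neq0// gt_eqF.
have rec k : (k <= T)%N ->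
    gap (z k.+1) - (1 + c1 * b k ^+ 2) * gap (z k) <=
      - (kappa * b k / 2 * grad (z k) ^+ 2) + c2 * b k ^+ 2.
  by move=> kT; apply: one (st k kT) (bb k kT); apply: Xz; exact: leqW.
have gapK n : (n <= T.+1)%N -> gap (z n) <= K.
  move=> nT; rewrite /K -z0; apply: (@gap_bounded z b) => //.
  - exact: ltW.
  - by move=> k kn; apply: b_gt0; rewrite -ltnS (leq_trans kn).
  - by move=> k kn; apply: rec; rewrite -ltnS (leq_trans kn).
  - by rewrite -sbT; apply: nondecreasing_series => // k _ _; exact: sqr_ge0.
have := @min_le_telescope _ (gap \o z) (fun k => b k ^+ 2) b
  (fun k => grad (z k) ^+ 2) (grad (z 0%N) ^+ 2) kappa c3 T kappa_gt0.
move=> /(_ (gap_ge0 _) b_gt0) h.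
apply: le_trans (h _) _ => [k kT /=|/=].
  have := rec k kT.
  have : c1 * gap (z k) <= c1 * K by rewrite ler_pM2l// gapK// leqW.
  move=> /(ler_wpM2r (sqr_ge0 (b k))); rewrite /c3; lra.
have -> : \sum_(0 <= k < T.+1) b k ^+ 2 = Delta ^+ 2 := sbT.
have -> : \sum_(0 <= k < T.+1) b k = Delta * q.
  rewrite big_nat; under eq_bigr => k /andP[_ kT] do rewrite bE//.
  rewrite -big_nat sumr_const_nat subn0 -mulr_natl -qE.
  by field; rewrite gt_eqF.
by rewrite z0 ler_pdivlMr// invfM !mulrA mulfVK ?gt_eqF// lerDl.
Qed.

End prox_subgradient.

(** * Positivity of [M1], and the theorem *)

Lemma M1_gt0 (R : realType) (lambda c1 c3 a3 a4 a5 a6 : R) :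
  0 < lambda -> 0 < c1 -> 0 <= c3 ->
  0 <= a3 -> 0 <= a4 -> 0 <= a5 -> 0 <= a6 ->
  0 < a3 * c3 + a4 \/ 0 < a5 * c3 + a6 -> 0 < M1 lambda c1 c3 a3 a4 a5 a6.
Proof.
move=> l_gt0 c1_gt0 c3_ge0 a3_ge0 a4_ge0 a5_ge0 a6_ge0 pos.
have lc_gt0 : 0 < c1 ^+ 2 * lambda ^+ 2 by rewrite mulr_gt0 ?exprn_gt0.
rewrite /M1 lt_max !sqrtr_gt0; apply/orP; case: pos => pos; [left|right].
  move: a4_ge0 pos; rewrite le_eqVlt => /predU1P[<-|a4_gt0 _].
    by rewrite !addr0 => h; rewrite divr_gt0.
  by rewrite ltr_wpDl// divr_ge0 ?(ltW c1_gt0)// mulr_ge0.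
move: a6_ge0 pos; rewrite le_eqVlt => /predU1P[<-|a6_gt0 _].
  rewrite !addr0 => h; rewrite divr_gt0//.
  (* The assumption is linear in [c3] and the radicand quadratic: with [a6 = 0], the assumption
     forces [c3 > 0], hence [c3^2 > 0]. *)
  have : 0 < c3.
    by rewrite lt_neqAle c3_ge0 andbT; apply: contraTneq h => <-; rewrite mulr0 ltxx.
  have := h; rewrite expr2; nra.
by rewrite ltr_wpDl// divr_ge0 ?(ltW lc_gt0)// !mulr_ge0 ?sqr_ge0.
Qed.

Theorem theorem4p1 (R : realType) (d : nat) (X : set 'rV[R]_d)
    (f r : 'rV[R]_d -> R) (rho eta lambda : R)
    (G H : 'rV[R]_d -> set 'rV[R]_d) (C : condition R)
    (alpha beta : nat -> R) (x g : nat -> 'rV[R]_d)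
    (phi := f \+ r)
    (Xclosed : closed X) (Xconvex : convex_set X)
    (f_lsc : lsc_on X f) (r_lsc : lsc_on X r)
    (has_min : argmin X phi !=set0)
    (rho_ge0 : 0 <= rho) (eta_ge0 : 0 <= eta)
    (f_wconvex : weakly_convex X rho f) (r_wconvex : weakly_convex X eta r)
    (lambda_gt0 : 0 < lambda) (lambda_lt : lt_recip lambda (rho + 2 * eta))
    (G_oracle : oracle X (wsubdiff X rho f) G)
    (HC : condition_holds X f r eta lambda G H C)
    (beta_sigma : sigma_sequence beta)
    (alpha_beta : forall k, alpha k = beta k)
    (beta_step : forall k, step_bound rho eta lambda C (beta k))
    (x_run : prox_subgrad X r G alpha x g) :
  (exists gamma1 gamma2 : R,
     [/\ 0 < gamma1, 0 <= gamma2 &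
         envelope_recursion X phi rho eta lambda alpha beta x gamma1 gamma2])
  /\
  (forall gamma1 gamma2 : R, 0 <= gamma1 -> 0 <= gamma2 ->
     envelope_recursion X phi rho eta lambda alpha beta x gamma1 gamma2 ->
     (exists gamma3, gamma3_bound X phi lambda x gamma1 gamma2 gamma3)
     /\
     (forall gamma3, gamma3_bound X phi lambda x gamma1 gamma2 gamma3 ->
        (forall T : nat,
           min_grad_sq X phi lambda x T <=
             2 / (1 - lambda * (rho + 2 * eta)) *
             ((envelope_gap X lambda phi (x 0%N) +
                 gamma3 * \sum_(0 <= k < T.+1) beta k ^+ 2) /
                \sum_(0 <= k < T.+1) alpha k))
        /\
        (forall c3 c4 c5 c6 : R, 0 < gamma1 ->
           M1_constants X f r eta lambda G H C c3 c4 c5 c6 ->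
           let M := M1 lambda gamma1 gamma3 c3 c4 c5 c6 in
           [/\ 0 < c3 * gamma3 + c4 \/ 0 < c5 * gamma3 + c6 -> 0 < M,
               forall k h, H (x k) h -> enorm (g k + h) <= M &
               forall k, enorm (x k - x k.+1) <= 2 * M * alpha k])))
  /\
  (forall Delta1 : R, 0 < Delta1 ->
     exists R1 : R, 0 < R1 /\
       forall (T : nat) (b : nat -> R) (z gz : nat -> 'rV[R]_d),
         (forall k, (k <= T)%N -> b k = Delta1 / Num.sqrt T.+1%:R) ->
         (forall k, (k <= T)%N -> step_bound rho eta lambda C (b k)) ->
         z 0%N = x 0%N ->
         (forall k, (k <= T)%N ->
            prox_subgrad_step X r G (b k) (z k) (gz k) (z k.+1)) ->
         min_grad_sq X phi lambda z T <= R1 / Num.sqrt T.+1%:R)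
  /\
  match C with
  | CondDD _ => True
  | Cond3 _ _ => env_grad_norm X lambda phi (x k) @[k --> \oo] --> (0 : R)
  | Cond4 c5 c6 =>
      condition_holds X f r eta lambda G H (Cond3 (2 * c5 / lambda) c6) /\
      (env_grad_norm X lambda phi (x k) @[k --> \oo] --> (0 : R))
  end.
Proof.
have gap0 : forall y, 0 <= envelope_gap X lambda phi y.
  exact: (gap_ge0 Xclosed Xconvex f_lsc r_lsc has_min rho_ge0 eta_ge0
    f_wconvex r_wconvex lambda_gt0 lambda_lt).
have [beta_gt0 _ _] := beta_sigma.
split; last (split; last split).
- have [c1 [c2 [c1_gt0 c2_ge0 one]]] := one_step_recursion_exists Xclosed Xconvex
    f_lsc r_lsc has_min rho_ge0 eta_ge0 f_wconvex r_wconvex lambda_gt0 lambda_lt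
    G_oracle HC.
  exists c1, c2; split=> // k; have := x_run.2 k; rewrite alpha_beta => st.
  exact: one (prox_subgrad_in x_run k) st (beta_step k).
- move=> c1 c2 c1_ge0 c2_ge0 rec; split.
    have [K gapK] := gap_bounded_run Xclosed Xconvex f_lsc r_lsc has_min rho_ge0
      eta_ge0 f_wconvex r_wconvex lambda_gt0 lambda_lt beta_sigma alpha_beta
      c1_ge0 c2_ge0 rec.
    by exists (c1 * K + c2) => k; rewrite lerD2r ler_wpM2l.
  move=> c3 c3P; split=> [T|a3 a4 a5 a6 c1_gt0 aC M].
    exact: (min_grad_sq_le Xclosed Xconvex f_lsc r_lsc has_min rho_ge0
      eta_ge0 f_wconvex r_wconvex lambda_gt0 lambda_lt beta_sigma alpha_beta T
      rec c3P).
  (* Under [Cond4] the pair [c3], [c4] of [M1] satisfies [Cond3], and both conditions share one step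
     size bound, so the rest is argued under [Cond3]. *)
  have [hC3 bb a5_ge0 a6_ge0] :
      [/\ condition_holds X f r eta lambda G H (Cond3 a3 a4),
          (forall k, step_bound rho eta lambda (Cond3 a3 a4) (beta k)),
          0 <= a5 & 0 <= a6].
    case: C HC aC beta_step => [//|b3 b4 h [-> -> ? ?]//|b5 b6 [? ? _ _]].
    by move=> [-> -> ?].
  have [a3_ge0 a4_ge0 Ho _] := hC3.
  have hM k h : H (x k) h -> enorm (g k + h) <= M.
    exact: (subgradient_sum_le_M1 x_run a5 a6 hC3 c1_gt0 c2_ge0 c3P).
  split=> //.
    (* Here [gamma3 >= 0] is read off its defining inequality at [k = 0]. *)
    apply: M1_gt0 => //; apply: le_trans (c3P 0%N).
    by rewrite addr_ge0// mulr_ge0.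
  move=> k; have [[h Hh] _] := Ho _ (prox_subgrad_in x_run k).
  exact: (run_step_length Xconvex eta_ge0 r_wconvex beta_sigma alpha_beta
    x_run hC3 bb Hh (hM _ _ Hh)).
- move=> Delta D_gt0.
  exact: (constant_step_rate Xclosed Xconvex f_lsc r_lsc has_min rho_ge0 eta_ge0
    f_wconvex r_wconvex lambda_gt0 lambda_lt G_oracle x_run.1 HC D_gt0).
- have lim a3 a4 : condition_holds X f r eta lambda G H (Cond3 a3 a4) ->
      (forall k, step_bound rho eta lambda (Cond3 a3 a4) (beta k)) ->
      env_grad_norm X lambda phi (x k) @[k --> \oo] --> (0 : R).
    exact: (env_grad_norm_cvg0 Xclosed Xconvex f_lsc r_lsc has_min rho_ge0
      eta_ge0 f_wconvex r_wconvex lambda_gt0 lambda_lt G_oracle beta_sigma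
      alpha_beta x_run).
  case: C HC beta_step => [//|a3 a4 h bb|c5 c6 h bb]; first exact: lim h bb.
  have h3 := Cond4_Cond3 Xclosed Xconvex f_lsc r_lsc has_min rho_ge0 eta_ge0
    f_wconvex r_wconvex lambda_gt0 lambda_lt h.
  by split=> //; exact: lim h3 bb.
Qed.
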